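(* The group $(F_4)^{\gamma_3}\cap(F_4)^{w_3}$ is isomorphic to $(U(1)\times U(1)\times SU(3))/\mathbb{Z}_3$, where $\mathbb{Z}_3=\{(1,1,E),(\boldsymbol{\omega},\boldsymbol{\omega},\boldsymbol{\omega}E),(\boldsymbol{\omega}^{-1},\boldsymbol{\omega}^{-1},\boldsymbol{\omega}^{-1}E)\}$.
   Context: Let $\mathbf{H}$ be the quaternions with units $e_1,e_2,e_3=e_1e_2$, and $\mathbf{C}=\{x+ye_1: x,y\in\mathbb{R}\}\subset\mathbf{H}$. Let $\mathfrak{C}=\mathbf{H}\oplus\mathbf{H}e_4$ be the division Cayley algebra with multiplication $(m+ne_4)(p+qe_4)=(mp-\bar q n)+(n\bar p+qm)e_4$ and conjugation $\overline{m+ne_4}=\bar m-ne_4$. Let $\mathfrak{J}=\{X\in M(3,\mathfrak{C}): X^*=X\}$ be the exceptional Jordan algebra, with $X\circ Y=\tfrac12(XY+YX)$; its elements are $$X=\begin{pmatrix}\xi_1&x_3&\overline{x_2}\\ \overline{x_3}&\xi_2&x_1\\ x_2&\overline{x_1}&\xi_3\end{pmatrix},\quad \xi_i\in\mathbb{R},\ x_i\in\mathfrak{C}.$$ Put $F_4=\{\alpha\in\mathrm{Iso}_{\mathbb{R}}(\mathfrak{J}):\alpha(X\circ Y)=\alpha X\circ\alpha Y\}$, where $\mathrm{Iso}_{\mathbb{R}}$ denotes $\mathbb{R}$-linear isomorphisms. Let $\boldsymbol{\omega}=-\tfrac12+\tfrac{\sqrt3}{2}e_1\in\mathbf{C}$.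 On $\mathfrak{C}$ let $\gamma_3(m+ne_4)=m+(\boldsymbol{\omega}n)e_4$; and, writing $\mathfrak{C}=\mathbf{C}\oplus\mathbf{C}^3$ with $\mathbf{C}^3=\mathbf{C}e_2\oplus\mathbf{C}e_4\oplus\mathbf{C}e_6$ (where $e_6=\pm e_2e_4$; the sign is irrelevant) the orthogonal complement of $\mathbf{C}$, let $w_3(m_0+\mathbf{m})=m_0+\boldsymbol{\omega}\mathbf{m}$. Both are algebra automorphisms of $\mathfrak{C}$, and they are extended to elements $\gamma_3,w_3\in F_4$ by fixing each $\xi_i$ and acting on each $x_i$ ($i=1,2,3$). For $g\in F_4$, $(F_4)^g=\{\alpha\in F_4: g^{-1}\alpha g=\alpha\}$. $U(1)$ and $SU(3)$ are taken over the complex field $\mathbf{C}$; $E$ is the unit matrix. *)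

(* Defs.v *)
From HB Require Import structures.
From mathcomp Require Import all_boot all_order all_algebra.
From mathcomp Require Import boolp reals complex.
From mathcomp Require Import ring.

Set Implicit Arguments.
Unset Strict Implicit.
Unset Printing Implicit Defensive.

Import GRing.Theory Num.Theory.

Local Open Scope ring_scope.

Definition isomorphic (G H : groupType) : Prop :=
  exists f : {multiplicative G -> H}, bijective f.

Section QuotientGroup.
Local Open Scope group_scope.

Record normal_subgroup (G : groupType) := NormalSubgroup {
  nsub :> {pred G};
  nsub_group_closed : group_closed nsub;
  nsub_normal : forall x y : G, x \in nsub -> x ^ y \in nsub
}.

Variables (G : groupType) (N : normal_subgroup G).
Implicit Types x y z : G.

Let N1 : 1 \in N. Proof. by case: (nsub_group_closed N). Qed.
Let NM : {in N &, forall x y, x * y \in N}.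
Proof. by apply: group_closedM; exact: nsub_group_closed. Qed.
Let NV x : x \in N -> x^-1 \in N.
Proof. by apply: group_closedV; exact: nsub_group_closed. Qed.

Definition coset_rel x y := x^-1 * y \in N.

Lemma coset_rel_refl : reflexive coset_rel.
Proof. by move=> x; rewrite /coset_rel mulVg. Qed.
Lemma coset_rel_sym : symmetric coset_rel.
Proof.
suff H x y : coset_rel x y -> coset_rel y x.
  by move=> x y; apply/idP/idP; exact: H.
by move=> /NV; rewrite /coset_rel invgM invgK.
Qed.
Lemma coset_rel_trans : transitive coset_rel.
Proof.
by move=> y x z xy yz; have := NM xy yz; rewrite mulgA mulgK.
Qed.

Canonical coset_equiv :=
  EquivRel coset_rel coset_rel_refl coset_rel_sym coset_rel_trans.

Local Open Scope quotient_scope.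

Definition quotient_group := {eq_quot coset_rel}.
HB.instance Definition _ := Choice.on quotient_group.
HB.instance Definition _ := EqQuotient.on quotient_group.

Definition quotient_mul (a b : quotient_group) : quotient_group :=
  \pi_quotient_group (repr a * repr b).
Definition quotient_inv (a : quotient_group) : quotient_group :=
  \pi_quotient_group (repr a)^-1.

Lemma coset_relP x y :
  reflect (x = y %[mod quotient_group]) (coset_rel x y).
Proof. by apply: (iffP idP) => [xy|/eqmodP//]; apply/eqmodP. Qed.

Lemma coset_rel_repr x : coset_rel (repr (\pi_quotient_group x)) x.
Proof. by apply/coset_relP; rewrite reprK. Qed.

Lemma quotient_mulE x y :
  quotient_mul (\pi x) (\pi y) = \pi_quotient_group (x * y).
Proof.
apply/coset_relP; rewrite /coset_rel.
set x' := repr _; set y' := repr _.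
have hx : x'^-1 * x \in N by exact: coset_rel_repr.
have hy : y'^-1 * y \in N by exact: coset_rel_repr.
have -> : (x' * y')^-1 * (x * y) = (x'^-1 * x) ^ y' * (y'^-1 * y).
  by rewrite /conjg invgM !mulgA mulgK.
by apply: NM => //; exact: nsub_normal.
Qed.

Lemma quotient_invE x :
  quotient_inv (\pi x) = \pi_quotient_group x^-1.
Proof.
apply/coset_relP; rewrite /coset_rel.
set x' := repr _.
have hx : x'^-1 * x \in N by exact: coset_rel_repr.
have -> : (x'^-1)^-1 * x^-1 = ((x'^-1 * x)^-1) ^ x'^-1.
  by rewrite /conjg invgM !invgK !mulgA mulgK.
by apply: nsub_normal; exact: NV.
Qed.

Let Q1 : quotient_group := \pi_quotient_group 1.

Let quotient_mulA : associative quotient_mul.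
Proof.
by elim/quotW=> x; elim/quotW=> y; elim/quotW=> z; rewrite !quotient_mulE mulgA.
Qed.
Let quotient_mul1g : left_id Q1 quotient_mul.
Proof. by elim/quotW=> x; rewrite quotient_mulE mul1g. Qed.
Let quotient_mulg1 : right_id Q1 quotient_mul.
Proof. by elim/quotW=> x; rewrite quotient_mulE mulg1. Qed.
Let quotient_mulVg : left_inverse Q1 quotient_inv quotient_mul.
Proof. by elim/quotW=> x; rewrite quotient_invE quotient_mulE mulVg. Qed.
Let quotient_mulgV : right_inverse Q1 quotient_inv quotient_mul.
Proof. by elim/quotW=> x; rewrite quotient_invE quotient_mulE mulgV. Qed.

HB.instance Definition _ := isGroup.Build quotient_group
  quotient_mulA quotient_mul1g quotient_mulg1 quotient_mulVg quotient_mulgV.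

End QuotientGroup.

Section Centralizer.
Local Open Scope group_scope.
Variable G : groupType.

Definition fixed_by (g : G) : {pred G} := [pred a | g^-1 * a * g == a].

Lemma fixed_byP (g a : G) : reflect (commute a g) (a \in fixed_by g).
Proof.
rewrite inE; apply: (iffP eqP) => [h|ag].
  by rewrite /commute -[in RHS]h !mulgA mulgV mul1g.
by rewrite -mulgA ag mulKg.
Qed.

Lemma fixed_by_group_closed g : group_closed (fixed_by g).
Proof.
split; first exact/fixed_byP/esym/commute1.
move=> x y /fixed_byP xg /fixed_byP yg; apply/fixed_byP.
apply/commute_sym/commuteM; first exact: commute_sym.
by apply: commuteV; exact: commute_sym.
Qed.

End Centralizer.

Section LinearIso.
Variables (R : pzRingType) (V : lmodType R).

Record linear_iso := LinearIso {
  linear_iso_fun :> V -> V;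
  linear_iso_linear : linear linear_iso_fun;
  linear_iso_bij : bijective linear_iso_fun
}.

HB.instance Definition _ (f : linear_iso) :=
  GRing.isLinear.Build R V V _ (linear_iso_fun f) (linear_iso_linear f).

HB.instance Definition _ := gen_eqMixin linear_iso.
HB.instance Definition _ := gen_choiceMixin linear_iso.

Lemma linear_isoP (f g : linear_iso) : f =1 g -> f = g.
Proof.
case: f g => [f fl fb] [g gl gb] /= /funext fg.
by subst g; congr LinearIso; exact: Prop_irrelevance.
Qed.

Let one_linear : linear (@id V). Proof. by []. Qed.
Let one_bij : bijective (@id V). Proof. by exists id. Qed.

Definition linear_iso_one := LinearIso one_linear one_bij.

Section Mul.
Variables f g : linear_iso.
Let mul_linear : linear (f \o g).
Proof. by move=> a u v; rewrite /= !linearP. Qed.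
Let mul_bij : bijective (f \o g).
Proof. by apply: bij_comp; exact: linear_iso_bij. Qed.
Definition linear_iso_mul := LinearIso mul_linear mul_bij.
End Mul.

Section Inv.
Variable f : linear_iso.
Let inv_ex : exists g : V -> V, cancel f g /\ cancel g f.
Proof. by case: (linear_iso_bij f) => g fK gK; exists g. Qed.
Let g := projT1 (cid inv_ex).
Let fK : cancel f g. Proof. exact: (projT2 (cid inv_ex)).1. Qed.
Let gK : cancel g f. Proof. exact: (projT2 (cid inv_ex)).2. Qed.
Let inv_linear : linear g.
Proof.
move=> a u v; apply: (bij_inj (linear_iso_bij f)).
by rewrite linearP /= !gK.
Qed.
Let inv_bij : bijective g. Proof. by exists f. Qed.
Definition linear_iso_inv := LinearIso inv_linear inv_bij.
Lemma linear_iso_invK : cancel linear_iso_inv f. Proof. exact: gK. Qed.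
Lemma linear_isoK : cancel f linear_iso_inv. Proof. exact: fK. Qed.
End Inv.

Let mulA : associative linear_iso_mul.
Proof. by move=> f g h; apply: linear_isoP. Qed.
Let mul1 : left_id linear_iso_one linear_iso_mul.
Proof. by move=> f; apply: linear_isoP. Qed.
Let mulr1 : right_id linear_iso_one linear_iso_mul.
Proof. by move=> f; apply: linear_isoP. Qed.
Let mulV : left_inverse linear_iso_one linear_iso_inv linear_iso_mul.
Proof. by move=> f; apply: linear_isoP => x /=; exact: linear_isoK. Qed.
Let mulrV : right_inverse linear_iso_one linear_iso_inv linear_iso_mul.
Proof. by move=> f; apply: linear_isoP => x /=; exact: linear_iso_invK. Qed.

HB.instance Definition _ :=
  isGroup.Build linear_iso mulA mul1 mulr1 mulV mulrV.

End LinearIso.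

(* Quat a b c d is a + b e1 + c e2 + d e3.                                    *)
Record quat (R : Type) := Quat { q0 : R; q1 : R; q2 : R; q3 : R }.

Section QuatChoice.
Variable R : Type.
Definition quat_tuple (q : quat R) := (q0 q, q1 q, q2 q, q3 q).
Definition tuple_quat (t : R * R * R * R) :=
  Quat t.1.1.1 t.1.1.2 t.1.2 t.2.
Lemma quat_tupleK : cancel quat_tuple tuple_quat. Proof. by case. Qed.
End QuatChoice.

HB.instance Definition _ (R : choiceType) :=
  Choice.copy (quat R) (can_type (@quat_tupleK R)).

Section Quaternion.
Variable R : realType.
Local Notation H := (quat R).

Definition quat_add (x y : H) : H :=
  Quat (q0 x + q0 y) (q1 x + q1 y) (q2 x + q2 y) (q3 x + q3 y).
Definition quat_opp (x : H) : H :=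
  Quat (- q0 x) (- q1 x) (- q2 x) (- q3 x).
Definition quat_scale (k : R) (x : H) : H :=
  Quat (k * q0 x) (k * q1 x) (k * q2 x) (k * q3 x).
Definition quat_mul (x y : H) : H :=
  Quat (q0 x * q0 y - q1 x * q1 y - q2 x * q2 y - q3 x * q3 y)
       (q0 x * q1 y + q1 x * q0 y + q2 x * q3 y - q3 x * q2 y)
       (q0 x * q2 y - q1 x * q3 y + q2 x * q0 y + q3 x * q1 y)
       (q0 x * q3 y + q1 x * q2 y - q2 x * q1 y + q3 x * q0 y).

Lemma quat_eqP (x y : H) :
  q0 x = q0 y -> q1 x = q1 y -> q2 x = q2 y -> q3 x = q3 y -> x = y.
Proof. by case: x y => ? ? ? ? [] ? ? ? ? /= -> -> -> ->. Qed.

Ltac quat_ring := by move=> *; apply: quat_eqP => /=; ring.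

Let quat_addA : associative quat_add. Proof. quat_ring. Qed.
Let quat_addC : commutative quat_add. Proof. quat_ring. Qed.
Let quat_add0 : left_id (Quat 0 0 0 0) quat_add. Proof. quat_ring. Qed.
Let quat_addN : left_inverse (Quat 0 0 0 0) quat_opp quat_add.
Proof. quat_ring. Qed.

HB.instance Definition _ := GRing.isZmodule.Build (quat R)
  quat_addA quat_addC quat_add0 quat_addN.

Let quat_mulA : associative quat_mul. Proof. quat_ring. Qed.
Let quat_mul1 : left_id (Quat 1 0 0 0) quat_mul. Proof. quat_ring. Qed.
Let quat_mulr1 : right_id (Quat 1 0 0 0) quat_mul. Proof. quat_ring. Qed.
Let quat_mulDl : left_distributive quat_mul +%R. Proof. quat_ring. Qed.
Let quat_mulDr : right_distributive quat_mul +%R. Proof. quat_ring. Qed.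
Let quat_one_neq0 : Quat 1 0 0 0 != 0 :> H.
Proof. by apply/eqP => -[] /eqP; rewrite oner_eq0. Qed.

HB.instance Definition _ := GRing.Zmodule_isNzRing.Build (quat R)
  quat_mulA quat_mul1 quat_mulr1 quat_mulDl quat_mulDr quat_one_neq0.

Let quat_scaleA a b (x : H) :
  quat_scale a (quat_scale b x) = quat_scale (a * b) x.
Proof. quat_ring. Qed.
Let quat_scale1 : left_id 1 quat_scale. Proof. quat_ring. Qed.
Let quat_scaleDr : right_distributive quat_scale +%R. Proof. quat_ring. Qed.
Let quat_scaleDl (x : H) : {morph quat_scale^~ x : a b / a + b}.
Proof. quat_ring. Qed.

HB.instance Definition _ := GRing.Zmodule_isLmodule.Build R (quat R)
  quat_scaleA quat_scale1 quat_scaleDr quat_scaleDl.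

Definition quat_conj (x : H) : H := Quat (q0 x) (- q1 x) (- q2 x) (- q3 x).

(* The complex field R + R e1 of the quaternions is represented by R[i].      *)
Definition quat_of_complex (z : R[i]) : H :=
  Quat (complex.Re z) (complex.Im z) 0 0.

Definition omega : R[i] := Complex (- 2^-1) (Num.sqrt 3 / 2).

Lemma sqrt3K : Num.sqrt 3 * Num.sqrt 3 = 3 :> R.
Proof. by rewrite -expr2 sqr_sqrtr. Qed.

End Quaternion.

Section Cayley.
Variable R : realType.

(* The pair (m, n) is m + n e4.                                               *)
Definition cayley : Type := (quat R * quat R)%type.
HB.instance Definition _ := GRing.Lmodule.on cayley.

Implicit Types x y : cayley.

Definition cayley_mul x y : cayley :=
  (x.1 * y.1 - quat_conj y.2 * x.2, x.2 * quat_conj y.1 + y.2 * x.1).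
Definition cayley_conj x : cayley := (quat_conj x.1, - x.2).
Definition cayley_of_quat (q : quat R) : cayley := (q, 0).
Definition cayley_real (a : R) : cayley := cayley_of_quat (Quat a 0 0 0).
Definition cayley_re x : R := q0 x.1.

Lemma cayley_eqP x y :
  q0 x.1 = q0 y.1 -> q1 x.1 = q1 y.1 -> q2 x.1 = q2 y.1 -> q3 x.1 = q3 y.1 ->
  q0 x.2 = q0 y.2 -> q1 x.2 = q1 y.2 -> q2 x.2 = q2 y.2 -> q3 x.2 = q3 y.2 ->
  x = y.
Proof.
case: x y => [x1 x2] [y1 y2] /= *.
by congr pair; apply: quat_eqP.
Qed.

Lemma cayley_conjK : involutive cayley_conj.
Proof. by move=> x; apply: cayley_eqP => /=; ring. Qed.
Lemma cayley_conjM x y :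
  cayley_conj (cayley_mul x y) = cayley_mul (cayley_conj y) (cayley_conj x).
Proof. by apply: cayley_eqP => /=; ring. Qed.
Lemma cayley_conj_linear : linear cayley_conj.
Proof. by move=> a x y; apply: cayley_eqP => /=; ring. Qed.
HB.instance Definition _ :=
  GRing.isLinear.Build R cayley cayley _ cayley_conj cayley_conj_linear.

Definition gamma3 x : cayley := (x.1, quat_of_complex (omega R) * x.2).

(* Orthogonal projection of the Cayley algebra on R + R e1; its kernel is the *)
(* complement C e2 + C e4 + C e6, on which C acts by left multiplication.     *)
Definition cayley_Cpart x : cayley :=
  cayley_of_quat (Quat (q0 x.1) (q1 x.1) 0 0).
Definition w3 x : cayley :=
  cayley_Cpart x +
  cayley_mul (cayley_of_quat (quat_of_complex (omega R))) (x - cayley_Cpart x).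

(* Commutation with conjugation follows from the other conditions; it is kept *)
(* as a field because the extension to Hermitian matrices relies on it.       *)
Record cayley_automorphism (g : cayley -> cayley) : Prop := {
  caut_linear : linear g;
  caut_bij : bijective g;
  caut_mul : {morph g : x y / cayley_mul x y};
  caut_conj : {morph g : x / cayley_conj x}
}.

Ltac cayley_field :=
  apply: cayley_eqP => //=; (field: (sqrt3K R)); exact: isT.

Lemma gamma3_automorphism : cayley_automorphism gamma3.
Proof.
split.
- by move=> a x y; apply: cayley_eqP => /=; ring.
- by exists (gamma3 \o gamma3) => x; cayley_field.
- by move=> x y; cayley_field.
- by move=> x; cayley_field.
Qed.

Lemma w3_automorphism : cayley_automorphism w3.
Proof.
split.
- by move=> a x y; apply: cayley_eqP => /=; ring.
- by exists (w3 \o w3) => x; cayley_field.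
- by move=> x y; cayley_field.
- by move=> x; cayley_field.
Qed.

End Cayley.

Section ExceptionalJordan.
Variable R : realType.
Local Notation C := (cayley R).

Definition cayley_mx : Type := 'M[C]_3.
HB.instance Definition _ := GRing.Zmodule.on cayley_mx.

Implicit Types X Y : cayley_mx.

Definition cayley_mx_scale (a : R) X : cayley_mx :=
  \matrix_(i, j) (a *: X i j).

Let cmx_scaleA a b X :
  cayley_mx_scale a (cayley_mx_scale b X) = cayley_mx_scale (a * b) X.
Proof. by apply/matrixP => i j; rewrite !mxE scalerA. Qed.
Let cmx_scale1 : left_id 1 cayley_mx_scale.
Proof. by move=> X; apply/matrixP => i j; rewrite !mxE scale1r. Qed.
Let cmx_scaleDr : right_distributive cayley_mx_scale +%R.
Proof. by move=> a X Y; apply/matrixP => i j; rewrite !mxE scalerDr. Qed.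
Let cmx_scaleDl X : {morph cayley_mx_scale^~ X : a b / a + b}.
Proof. by move=> a b; apply/matrixP => i j; rewrite !mxE scalerDl. Qed.

HB.instance Definition _ := GRing.Zmodule_isLmodule.Build R cayley_mx
  cmx_scaleA cmx_scale1 cmx_scaleDr cmx_scaleDl.

Definition cayley_mx_mul X Y : cayley_mx :=
  \matrix_(i, j) \sum_k cayley_mul (X i k) (Y k j).
Definition cayley_mx_adj X : cayley_mx := \matrix_(i, j) cayley_conj (X j i).

Lemma cayley_mxDE X Y i j : (X + Y) i j = X i j + Y i j.
Proof. by rewrite mxE. Qed.
Lemma cayley_mxZE (a : R) X i j : (a *: X) i j = a *: X i j.
Proof. by rewrite mxE. Qed.

Lemma cayley_mx_adj_linear : linear cayley_mx_adj.
Proof.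
by move=> a X Y; apply/matrixP => i j; rewrite !mxE linearP.
Qed.
HB.instance Definition _ := GRing.isLinear.Build R cayley_mx cayley_mx _
  cayley_mx_adj cayley_mx_adj_linear.

Lemma cayley_mx_adjM X Y :
  cayley_mx_adj (cayley_mx_mul X Y) =
  cayley_mx_mul (cayley_mx_adj Y) (cayley_mx_adj X).
Proof.
apply/matrixP => i j; rewrite !mxE linear_sum; apply: eq_bigr => k _ /=.
by rewrite cayley_conjM !mxE.
Qed.

Definition hermitian : {pred cayley_mx} := [pred X | cayley_mx_adj X == X].

Lemma hermitian_submod_closed : submod_closed hermitian.
Proof.
split=> [|a X Y]; rewrite !inE ?linear0 // => /eqP hX /eqP hY.
by rewrite linearP /= hX hY.
Qed.

Record jordan := Jordan {
  jordan_val :> cayley_mx; _ : jordan_val \in hermitian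
}.

HB.instance Definition _ := [isSub for jordan_val].
HB.instance Definition _ := [Choice of jordan by <:].
HB.instance Definition _ := GRing.SubChoice_isSubLmodule.Build
  R cayley_mx hermitian jordan hermitian_submod_closed.

Implicit Types A B : jordan.

Lemma jordan_adj A : cayley_mx_adj A = A.
Proof. by case: A => X /= /eqP. Qed.

Lemma jordan_mul_subproof A B :
  2^-1 *: (cayley_mx_mul A B + cayley_mx_mul B A) \in hermitian.
Proof.
by rewrite inE linearZ linearD /= !cayley_mx_adjM !jordan_adj addrC.
Qed.
Definition jordan_mul A B : jordan := Jordan (jordan_mul_subproof A B).

Section Elt.
Variables (xi1 xi2 xi3 : R) (x1 x2 x3 : C).

Definition jordan_elt_mx : cayley_mx :=
  \matrix_(i, j) nth 0 (nth [::]
    [:: [:: cayley_real xi1;  x3;               cayley_conj x2];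
        [:: cayley_conj x3;   cayley_real xi2;  x1];
        [:: x2;               cayley_conj x1;   cayley_real xi3]] i) j.

Lemma cayley_conj_real (a : R) : cayley_conj (cayley_real a) = cayley_real a.
Proof. by apply: cayley_eqP => /=; ring. Qed.

Lemma jordan_elt_subproof : jordan_elt_mx \in hermitian.
Proof.
rewrite inE; apply/eqP/matrixP => -[[|[|[|i]]] ilt] // [[|[|[|j]]] jlt] //;
  by rewrite !mxE /= ?cayley_conj_real ?cayley_conjK.
Qed.
Definition jordan_elt : jordan := Jordan jordan_elt_subproof.
End Elt.

Definition jordan_xi1 A : R := cayley_re (jordan_val A 0 0).
Definition jordan_xi2 A : R := cayley_re (jordan_val A 1 1).
Definition jordan_xi3 A : R := cayley_re (jordan_val A 2 2).
Definition jordan_x1 A : C := jordan_val A 1 2.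
Definition jordan_x2 A : C := jordan_val A 2 0.
Definition jordan_x3 A : C := jordan_val A 0 1.

Lemma cayley_conj_fixed (x : C) :
  cayley_conj x = x -> x = cayley_real (cayley_re x).
Proof.
have E (a : R) : - a = a -> a = 0.
  by move=> /eqP; rewrite eq_sym -addr_eq0 -mulr2n mulrn_eq0 /= => /eqP.
by case: x => -[a b c d] [a' b' c' d'] [] *; congr (Quat _ _ _ _, Quat _ _ _ _);
  apply: E.
Qed.

Lemma jordan_eltE A :
  A = jordan_elt (jordan_xi1 A) (jordan_xi2 A) (jordan_xi3 A)
                 (jordan_x1 A) (jordan_x2 A) (jordan_x3 A).
Proof.
have hA i j : cayley_conj (jordan_val A j i) = jordan_val A i j.
  by rewrite -[in RHS]jordan_adj mxE.
apply/val_inj/matrixP => i j; rewrite [RHS]mxE.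
case: i => -[|[|[|i]]] ilt //; case: j => -[|[|[|j]]] jlt //=;
  rewrite ?/jordan_x1 ?/jordan_x2 ?/jordan_x3 ?hA -?cayley_conj_fixed ?hA //;
  congr (jordan_val A _ _); exact: val_inj.
Qed.

Definition jordan_extend (g : C -> C) A : jordan :=
  jordan_elt (jordan_xi1 A) (jordan_xi2 A) (jordan_xi3 A)
             (g (jordan_x1 A)) (g (jordan_x2 A)) (g (jordan_x3 A)).

Section Extend.
Variables (g : C -> C) (gP : cayley_automorphism g).

HB.instance Definition _ := GRing.isLinear.Build R C C _ g (caut_linear gP).

Lemma caut_real (a : R) : g (cayley_real a) = cayley_real a.
Proof.
have one_r x : cayley_mul x (cayley_real 1) = x.
  by apply: cayley_eqP => /=; ring.
have one_l x : cayley_mul (cayley_real 1) x = x.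
  by apply: cayley_eqP => /=; ring.
have g1 : g (cayley_real 1) = cayley_real 1.
  case: (caut_bij gP) => h gK hK.
  by rewrite -[LHS]one_r -{2}[cayley_real 1]hK -(caut_mul gP) one_l hK.
have -> : cayley_real a = a *: cayley_real 1.
  by apply: cayley_eqP => /=; ring.
by rewrite linearZ /= g1.
Qed.

Lemma jordan_extendE A i j :
  jordan_val (jordan_extend g A) i j = g (jordan_val A i j).
Proof.
rewrite [in RHS](jordan_eltE A) !mxE.
case: i => -[|[|[|i]]] ilt //; case: j => -[|[|[|j]]] jlt //=;
  by rewrite ?caut_real ?(caut_conj gP).
Qed.

Lemma jordan_extend_linear : linear (jordan_extend g).
Proof.
move=> a A B; apply/val_inj/matrixP => i j.
rewrite [LHS]jordan_extendE !linearP /= !cayley_mxDE !cayley_mxZE.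
by rewrite !jordan_extendE linearP.
Qed.

Lemma jordan_extend_bij : bijective (jordan_extend g).
Proof.
have extK (f h : C -> C) :
    cancel f h -> cancel (jordan_extend f) (jordan_extend h).
  move=> fK A; rewrite [RHS]jordan_eltE /jordan_extend.
  congr jordan_elt; rewrite /jordan_xi1 /jordan_xi2 /jordan_xi3;
    by rewrite /jordan_x1 /jordan_x2 /jordan_x3 /= mxE //= fK.
by case: (caut_bij gP) => h gK hK; exists (jordan_extend h); exact: extK.
Qed.

Lemma jordan_extendM :
  {morph jordan_extend g : A B / jordan_mul A B}.
Proof.
have mxM A B i j : g (cayley_mx_mul A B i j) =
    cayley_mx_mul (jordan_extend g A) (jordan_extend g B) i j.
  rewrite !mxE linear_sum; apply: eq_bigr => k _ /=.
  by rewrite (caut_mul gP); congr cayley_mul; rewrite -jordan_extendE.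
move=> A B; apply/val_inj/matrixP => i j.
rewrite [LHS]jordan_extendE /= !cayley_mxZE !cayley_mxDE.
by rewrite linearZ linearD /= !mxM.
Qed.

Definition jordan_extend_iso : linear_iso jordan :=
  LinearIso jordan_extend_linear jordan_extend_bij.

End Extend.

Definition F4_pred : {pred linear_iso jordan} :=
  [pred f : linear_iso jordan |
     `[< forall A B, f (jordan_mul A B) = jordan_mul (f A) (f B) >]].

Lemma F4_group_closed : group_closed F4_pred.
Proof.
split; first exact/asboolP.
move=> f g /asboolP fM /asboolP gM; apply/asboolP => A B /=.
rewrite -fM; congr (f _); apply: (bij_inj (linear_iso_bij g)).
by rewrite gM !linear_iso_invK.
Qed.

Record F4 := MkF4 { F4_val :> linear_iso jordan; _ : F4_val \in F4_pred }.

HB.instance Definition _ := [isSub for F4_val].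
HB.instance Definition _ := [Choice of F4 by <:].
HB.instance Definition _ := SubChoice_isSubGroup.Build
  (linear_iso jordan) F4_pred F4 F4_group_closed.

Lemma F4_extend_subproof g (gP : cayley_automorphism g) :
  jordan_extend_iso gP \in F4_pred.
Proof. by apply/asboolP; exact: jordan_extendM. Qed.

Definition F4_extend g (gP : cayley_automorphism g) : F4 :=
  MkF4 (F4_extend_subproof gP).

Definition F4_gamma3 : F4 := F4_extend (gamma3_automorphism R).
Definition F4_w3 : F4 := F4_extend (w3_automorphism R).

Definition F4_gamma3_w3_pred : {pred F4} :=
  [predI fixed_by F4_gamma3 & fixed_by F4_w3].

Lemma F4_gamma3_w3_group_closed : group_closed F4_gamma3_w3_pred.
Proof.
have [g1 gD] := fixed_by_group_closed F4_gamma3.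
have [w1 wD] := fixed_by_group_closed F4_w3.
split=> [|f h]; rewrite !inE; first exact/andP.
by move=> /andP[fg fw] /andP[hg hw]; apply/andP; split; [exact: gD|exact: wD].
Qed.

Record F4_gamma3_w3 := MkF4gw {
  F4gw_val :> F4; _ : F4gw_val \in F4_gamma3_w3_pred
}.

HB.instance Definition _ := [isSub for F4gw_val].
HB.instance Definition _ := [Choice of F4_gamma3_w3 by <:].
HB.instance Definition _ := SubChoice_isSubGroup.Build
  F4 F4_gamma3_w3_pred F4_gamma3_w3 F4_gamma3_w3_group_closed.

End ExceptionalJordan.

Section UnitaryGroups.
Variable R : realType.
Local Notation C := R[i].

Record U1 := MkU1 { U1_val :> C; _ : `|U1_val| == 1 }.
HB.instance Definition _ := [isSub for U1_val].
HB.instance Definition _ := [Choice of U1 by <:].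

Implicit Types u v : U1.

Lemma U1P u : `|U1_val u| = 1. Proof. by apply/eqP; case: u. Qed.
Lemma U1_neq0 u : U1_val u != 0.
Proof. by rewrite -normr_eq0 U1P oner_eq0. Qed.

Let U1_one_subproof : `|1 : C| == 1. Proof. by rewrite normr1. Qed.
Let U1_mul_subproof u v : `|U1_val u * U1_val v| == 1.
Proof. by rewrite normrM !U1P mulr1. Qed.
Let U1_inv_subproof u : `|(U1_val u)^-1| == 1.
Proof. by rewrite normfV U1P invr1. Qed.

Definition U1_one := MkU1 U1_one_subproof.
Definition U1_mul u v := MkU1 (U1_mul_subproof u v).
Definition U1_inv u := MkU1 (U1_inv_subproof u).

Let U1_mulA : associative U1_mul.
Proof. by move=> u v w; apply: val_inj; rewrite /= mulrA. Qed.
Let U1_mul1 : left_id U1_one U1_mul.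
Proof. by move=> u; apply: val_inj; rewrite /= mul1r. Qed.
Let U1_mulr1 : right_id U1_one U1_mul.
Proof. by move=> u; apply: val_inj; rewrite /= mulr1. Qed.
Let U1_mulV : left_inverse U1_one U1_inv U1_mul.
Proof. by move=> u; apply: val_inj; rewrite /= mulVf ?U1_neq0. Qed.
Let U1_mulrV : right_inverse U1_one U1_inv U1_mul.
Proof. by move=> u; apply: val_inj; rewrite /= mulfV ?U1_neq0. Qed.

HB.instance Definition _ :=
  isGroup.Build U1 U1_mulA U1_mul1 U1_mulr1 U1_mulV U1_mulrV.

Record SU3 := MkSU3 {
  SU3_val :> 'M[C]_3;
  _ : (SU3_val \is unitarymx) && (\det SU3_val == 1)
}.
HB.instance Definition _ := [isSub for SU3_val].
HB.instance Definition _ := [Choice of SU3 by <:].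

Implicit Types A B : SU3.

Lemma SU3_unitary A : SU3_val A \is unitarymx.
Proof. by case: A => M /= /andP[]. Qed.
Lemma SU3_det A : \det (SU3_val A) = 1.
Proof. by apply/eqP; case: A => M /= /andP[]. Qed.
Lemma SU3_unitmx A : SU3_val A \in unitmx.
Proof. exact/unitarymx_unit/SU3_unitary. Qed.

Let SU3_one_subproof :
  ((1%:M : 'M[C]_3) \is unitarymx) && (\det (1%:M : 'M[C]_3) == 1).
Proof.
rewrite det1 eqxx andbT; apply/unitarymxP.
by rewrite mul1mx trmx1 map_mx1.
Qed.
Let SU3_mul_subproof A B :
  (SU3_val A *m SU3_val B \is unitarymx) &&
  (\det (SU3_val A *m SU3_val B) == 1).
Proof. by rewrite mul_unitarymx ?SU3_unitary // det_mulmx !SU3_det mulr1 /=. Qed.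
Let SU3_inv_subproof A :
  (invmx (SU3_val A) \is unitarymx) && (\det (invmx (SU3_val A)) == 1).
Proof.
rewrite det_inv SU3_det invr1 eqxx andbT invmx_unitary ?SU3_unitary //.
by rewrite trmxC_unitary SU3_unitary.
Qed.

Definition SU3_one := MkSU3 SU3_one_subproof.
Definition SU3_mul A B := MkSU3 (SU3_mul_subproof A B).
Definition SU3_inv A := MkSU3 (SU3_inv_subproof A).

Let SU3_mulA : associative SU3_mul.
Proof. by move=> A B D; apply: val_inj; rewrite /= mulmxA. Qed.
Let SU3_mul1 : left_id SU3_one SU3_mul.
Proof. by move=> A; apply: val_inj; rewrite /= mul1mx. Qed.
Let SU3_mulr1 : right_id SU3_one SU3_mul.
Proof. by move=> A; apply: val_inj; rewrite /= mulmx1. Qed.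
Let SU3_mulV : left_inverse SU3_one SU3_inv SU3_mul.
Proof. by move=> A; apply: val_inj; rewrite /= mulVmx ?SU3_unitmx. Qed.
Let SU3_mulrV : right_inverse SU3_one SU3_inv SU3_mul.
Proof. by move=> A; apply: val_inj; rewrite /= mulmxV ?SU3_unitmx. Qed.

HB.instance Definition _ :=
  isGroup.Build SU3 SU3_mulA SU3_mul1 SU3_mulr1 SU3_mulV SU3_mulrV.

Definition U1_U1_SU3 : groupType := (U1 * U1 * SU3)%type.

Local Notation w := (omega R).

Lemma omega3 : w ^+ 3 = 1.
Proof.
apply/eqP; rewrite !exprS expr0 eq_complex /=.
apply/andP; split; apply/eqP; (field: (sqrt3K R)); exact: isT.
Qed.

Definition Z3_pred : {pred U1_U1_SU3} :=
  [pred g : U1_U1_SU3 |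
     (val g.1.1, val g.1.2, val g.2) \in
       [:: (1, 1, 1%:M); (w, w, w%:M); (w^-1, w^-1, w^-1%:M)]].

Lemma Z3_group_closed : group_closed Z3_pred.
Proof.
have w0 : w != 0 
  by apply/eqP => w0; move: omega3; rewrite w0 expr0n => /esym/eqP;
    rewrite oner_eq0.
have w2 : w * w = w^-1.
  by apply: (mulIf w0); rewrite mulVf // -omega3 !exprS expr0 mulr1 mulrA.
have wV2 : w^-1 * w^-1 = w by rewrite -invfM w2 invrK.
have invwM : invmx (w%:M : 'M[C]_3) = w^-1%:M by rewrite invmx_scalar.
have invwVM : invmx (w^-1%:M : 'M[C]_3) = w%:M by rewrite invmx_scalar invrK.
split=> [|[[a b] A] [[a' b'] A']]; first by rewrite !inE eqxx.
rewrite !inE !xpair_eqE /= -!andbA.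
by move=> /or3P[] /and3P[/eqP-> /eqP-> /eqP->];
  move=> /or3P[] /and3P[/eqP-> /eqP-> /eqP->];
  rewrite ?invmx1 ?invwM ?invwVM -?scalar_mxM ?invr1 ?mul1mx ?mulmx1 ?mul1r
    ?mulr1 ?invrK ?w2 ?wV2 ?mulfV ?mulVf ?invr_eq0 // !eqxx ?orbT.
Qed.

Lemma Z3_normal (g h : U1_U1_SU3) :
  g \in Z3_pred -> (g ^ h)%g \in Z3_pred.
Proof.
case: g h => [[a b] A] [[a' b'] A'].
rewrite !inE !xpair_eqE /= -!andbA.
have U (x y : C) : y != 0 -> y^-1 * (x * y) = x.
  by move=> y0; rewrite mulrC mulfK.
have S (x : C) (B : SU3) : invmx B *m (x%:M *m B) = x%:M.
  by rewrite -scalar_mxC mulKmx ?SU3_unitmx.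
by move=> /or3P[] /and3P[/eqP-> /eqP-> /eqP->];
  rewrite ?(U _ _ (U1_neq0 _)) ?S !eqxx ?orbT.
Qed.

Definition Z3 : normal_subgroup U1_U1_SU3 :=
  NormalSubgroup Z3_group_closed Z3_normal.

End UnitaryGroups.

(* Main.v *)
Require Import Defs.
From HB Require Import structures.
From mathcomp Require Import all_boot all_order all_algebra.
From mathcomp Require Import boolp reals complex.
From mathcomp Require Import ring.

Set Implicit Arguments.
Unset Strict Implicit.
Unset Printing Implicit Defensive.

Import Order.TTheory GRing.Theory Num.Theory.

Local Open Scope ring_scope.
Local Open Scope sesquilinear_scope.

(* The exceptional Jordan algebra is identified with pairs (X, M) of a        *)
(* Hermitian and an arbitrary complex 3 x 3 matrix, so that w3 multiplies M   *)
(* by omega and gamma3 multiplies its rows by 1, omega, omega^2.  The triple  *)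
(* (a, b, A) acts by (X, M) |-> (A X A^*, P M A^* ), P = diag(a, b, 1/(ab)).  *)
(* Conversely, an automorphism commuting with w3 and gamma3 preserves the     *)
(* summand of the X and each row of M, where it acts C-linearly, say by       *)
(* v |-> v Q_k.  As X o v = v (tr X - X) / 2 for a row v, it must act on the  *)
(* X by Q_k^-1 X Q_k.  Hence Q_k Q_0^-1 and Q_0 Q_0^* commute with all        *)
(* Hermitian matrices and are scalars, so the automorphism is v |-> p_k v A^* *)
(* on row k, up to normalizing det A to 1 with a cube root; the products of   *)
(* rows then give |p_k| = 1 and p_0 p_1 p_2 = 1.                              *)

(** The triples (a, b, A) act through a homomorphism [act_hom], which is onto the group in question
    and has kernel Z_3; the first isomorphism theorem then gives the claim.

    It acts by automorphisms because, in the pair model, the Jordan product is built from matrix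
    products, traces, Gram matrices and a polarized cofactor ([jordan_C_mul], [jordan_M_mul]), all
    equivariant under unitary matrices of determinant 1 and phases of product 1 ([albertC_act],
    [albertM_act]). The action commutes with w3 and gamma3 because these too are diagonal left
    multiplications of M ([F4_w3E], [F4_gamma3E]).

    Surjectivity is [albert_pair_form], an argument in the style of Schur's lemma: gamma3 separates
    the rows of M by its eigenvalues, and the matrices acting on the rows all intertwine X with the
    same [beta X], so they are proportional ([centralizer_hermitian]).

    A triple acts trivially exactly when A and P are the same scalar matrix, whose scalar is then a
    cube root of unity ([Z3_act], [act_Z3]). *)

Lemma surjective_hom_isomorphic (G H : groupType) (N : normal_subgroup G)
    (f : G -> H) :
    {morph f : x y / (x * y)%g} -> (forall h, exists g, f g = h) ->
    (forall g, f g = 1%g -> g \in nsub N) ->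
    (forall g, g \in nsub N -> f g = 1%g) ->
  isomorphic H (quotient_group N).
Proof.
move=> fM fS fK fN.
have f1 : f 1%g = 1%g.
  by apply: (mulgI (f 1%g)); rewrite -fM !mulg1.
have fV x : f (x^-1)%g = ((f x)^-1)%g.
  by apply: (mulgI (f x)); rewrite -fM !mulgV.
pose s h := projT1 (cid (fS h)).
have sK h : f (s h) = h by exact: projT2 (cid (fS h)).
have fE x y : f x = f y <->
    (\pi_(quotient_group N) x = \pi_(quotient_group N) y)%qT.
  split=> [fxy|/coset_relP].
    by apply/coset_relP/fK; rewrite fM fV fxy mulVg.
  by move=> /fN; rewrite fM fV => h; apply: (mulgI (f x)^-1%g); rewrite h mulVg.
(* The isomorphism sends [h] to the class of a chosen preimage; by [fE] the choice does not
   matter. *)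
pose q h := (\pi_(quotient_group N) (s h))%qT.
have qM : {morph q : x y / (x * y)%g}.
  move=> x y; apply: etrans (esym (quotient_mulE _ _ _)).
  by apply/fE; rewrite fM !sK.
have q_bij : bijective q.
  exists (f \o repr) => [h|u].
    by rewrite /= -[RHS]sK; apply/fE; rewrite reprK.
  by rewrite -[RHS]reprK; apply/fE; rewrite sK.
pose Q := HB.pack_for {multiplicative H -> quotient_group N} q
  (isMultiplicative.Build H (quotient_group N) q qM).
by exists Q.
Qed.

Lemma conjCE (R : rcfType) (a b : R) : (Complex a b)^* = Complex a (- b).
Proof. by []. Qed.

(** * Complex coordinates on the exceptional Jordan algebra *)

Lemma sum3E (V : nmodType) (f : 'I_3 -> V) : \sum_k f k = f 0 + f 1 + f 2.
Proof.
rewrite !big_ord_recl big_ord0 addr0 addrA.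
by congr (_ + f _ + f _); apply: val_inj.
Qed.

Lemma ord3_ind (P : 'I_3 -> Prop) : P 0 -> P 1 -> P 2 -> forall i, P i.
Proof.
move=> P0 P1 P2 [[|[|[|i]]] lti] //.
- by have -> : Ordinal lti = 0 by apply: val_inj.
- by have -> : Ordinal lti = 1 by apply: val_inj.
- by have -> : Ordinal lti = 2 by apply: val_inj.
Qed.

Lemma ord3_addE : ((0 + 1 = 1 :> 'I_3)%R * (0 + 2 = 2 :> 'I_3)%R *
  (1 + 1 = 2 :> 'I_3)%R * (1 + 2 = 0 :> 'I_3)%R *
  (2 + 1 = 0 :> 'I_3)%R * (2 + 2 = 1 :> 'I_3)%R)%type.
Proof. by do ?split; apply: val_inj. Qed.

Section Coordinates.
Variable R : realType.
Local Notation C := R[i].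

Definition cayley_z (x : cayley R) : C := Complex (q0 x.1) (q1 x.1).

(* Coordinates on C e2 + C e4 + C e6 with e6 = e2 e4: since e1 e6 = - e3 e4,  *)
(* the last one carries a sign.                                               *)
Definition cayley_m (x : cayley R) (k : 'I_3) : C :=
  nth 0 [:: Complex (q2 x.1) (q3 x.1); Complex (q0 x.2) (q1 x.2);
            Complex (q2 x.2) (- q3 x.2)] k.

Definition cayley_of (z : C) (m : 'I_3 -> C) : cayley R :=
  (Quat (complex.Re z) (complex.Im z) (complex.Re (m 0)) (complex.Im (m 0)),
   Quat (complex.Re (m 1)) (complex.Im (m 1))
        (complex.Re (m 2)) (- complex.Im (m 2))).

Lemma cayley_z_of z m : cayley_z (cayley_of z m) = z.
Proof. by case: z. Qed.
Lemma cayley_m_of z m k : cayley_m (cayley_of z m) k = m k.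
Proof.
by elim/ord3_ind: k; rewrite /cayley_m /= ?opprK; case: (m _).
Qed.

Lemma cayley_coordP x y : cayley_z x = cayley_z y ->
  cayley_m x =1 cayley_m y -> x = y.
Proof.
move=> [h0 h1] h; have [h2 h3] := h 0; have [h4 h5] := h 1.
have [h6 /oppr_inj h7] := h 2.
exact: cayley_eqP.
Qed.

Ltac complex_ring := apply/eqP; rewrite eq_complex /=; apply/andP;
  split; apply/eqP; ring.

Lemma cayley_z_conj x : cayley_z (cayley_conj x) = (cayley_z x)^*.
Proof. by []. Qed.
Lemma cayley_z_real (a : R) : cayley_z (cayley_real a) = a%:C%C.
Proof. by []. Qed.
Lemma cayley_m_conj x k : cayley_m (cayley_conj x) k = - cayley_m x k.
Proof. by elim/ord3_ind: k; rewrite /cayley_m /=; complex_ring. Qed.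
Lemma cayley_zD x y : cayley_z (x + y) = cayley_z x + cayley_z y.
Proof. by []. Qed.
Lemma cayley_zZ (a : R) x : cayley_z (a *: x) = a%:C%C * cayley_z x.
Proof. complex_ring. Qed.
Lemma cayley_mD x y k : cayley_m (x + y) k = cayley_m x k + cayley_m y k.
Proof. by elim/ord3_ind: k; rewrite /cayley_m /=; complex_ring. Qed.
Lemma cayley_mZ (a : R) x k : cayley_m (a *: x) k = a%:C%C * cayley_m x k.
Proof. by elim/ord3_ind: k; rewrite /cayley_m /=; complex_ring. Qed.

Lemma cayley_zM x y : cayley_z (cayley_mul x y) =
  cayley_z x * cayley_z y - \sum_k cayley_m x k * (cayley_m y k)^*.
Proof.
by rewrite sum3E /cayley_z /cayley_m /= !conjCE; complex_ring.
Qed.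
(** The last term is the conjugated vector product of C^3, with indices cyclic modulo 3. *)
Lemma cayley_mM x y k : cayley_m (cayley_mul x y) k =
  cayley_z x * cayley_m y k + (cayley_z y)^* * cayley_m x k +
  (cayley_m x (k + 1) * cayley_m y (k + 2)
   - cayley_m x (k + 2) * cayley_m y (k + 1))^*.
Proof.
by elim/ord3_ind: k; rewrite !ord3_addE /cayley_z /cayley_m /= !conjCE;
  complex_ring.
Qed.
Lemma cayley_z_gamma3 x : cayley_z (gamma3 x) = cayley_z x.
Proof. by []. Qed.
(** C e2 lies in H and is fixed. The last coordinate is conjugated relative to left multiplication
    by omega, hence the factor omega^2, the conjugate of omega. *)
Lemma cayley_m_gamma3 x k :
  cayley_m (gamma3 x) k = omega R ^+ k * cayley_m x k.
Proof.
elim/ord3_ind: k; rewrite /cayley_m /= ?expr0 ?expr1 ?mul1r //.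
  by complex_ring.
by apply/eqP; rewrite eq_complex /=; apply/andP;
  split; apply/eqP; (field: (sqrt3K R)).
Qed.
Lemma cayley_z_w3 x : cayley_z (w3 x) = cayley_z x.
Proof. complex_ring. Qed.
Lemma cayley_m_w3 x k : cayley_m (w3 x) k = omega R * cayley_m x k.
Proof.
by elim/ord3_ind: k; rewrite /cayley_m /=; complex_ring.
Qed.

End Coordinates.

(* The polarization of twice the cofactor matrix.                             *)
Definition cross_mx (K : comNzRingType) (M N : 'M[K]_3) : 'M[K]_3 :=
  \matrix_(k, i) (M (k + 1) (i + 1) * N (k + 2) (i + 2)
                - M (k + 2) (i + 1) * N (k + 1) (i + 2)
                + N (k + 1) (i + 1) * M (k + 2) (i + 2)
                - N (k + 2) (i + 1) * M (k + 1) (i + 2)).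

Section AlbertProduct.
Variable K : numClosedFieldType.
Implicit Types X Y M N : 'M[K]_3.

(* The two components of the Jordan product of (X, M) and (Y, N) in the model *)
(* H_3(C) + M_3(C) of the exceptional Jordan algebra.                         *)
Definition albertC X Y M N : 'M[K]_3 := 2^-1 *:
  (X *m Y + Y *m X - N^t* *m M - M^t* *m N
   + (\tr (N^t* *m M) + \tr (M^t* *m N))%:M).

Definition albertM X Y M N : 'M[K]_3 := 2^-1 *:
  (M *m ((\tr Y)%:M - Y) + N *m ((\tr X)%:M - X)
   - map_mx Num.conj (cross_mx M N)).

End AlbertProduct.

Arguments cayley_z : simpl never.
Arguments cayley_m : simpl never.

HB.lock Definition jordan_C (R : realType) (A : jordan R) : 'M[R[i]]_3 :=
  \matrix_(i, j) cayley_z (jordan_val A i j).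

(* The columns are the C^3-parts of x1, x2, x3.                               *)
HB.lock Definition jordan_M (R : realType) (A : jordan R) : 'M[R[i]]_3 :=
  \matrix_(k, i) cayley_m (jordan_val A (i + 1) (i + 2)) k.

(* A section of V |-> (jordan_C V, jordan_M V) when X is Hermitian; it reads  *)
(* only the entries X 0 1, X 1 2, X 2 0 and the real parts of the diagonal.   *)
HB.lock Definition jordan_of (R : realType) (X M : 'M[R[i]]_3) : jordan R :=
  jordan_elt (complex.Re (X 0 0)) (complex.Re (X 1 1)) (complex.Re (X 2 2))
    (cayley_of (X 1 2) (M^~ 0)) (cayley_of (X 2 0) (M^~ 1))
    (cayley_of (X 0 1) (M^~ 2)).

(** * The Jordan product in the pair model *)

Section JordanCoordinates.
Variable R : realType.
Local Notation C := R[i].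
Implicit Types (A B : jordan R) (X Y M N : 'M[C]_3).

Lemma jordan_CE A i j : jordan_C A i j = cayley_z (jordan_val A i j).
Proof. by rewrite jordan_C.unlock mxE. Qed.
Lemma jordan_ME A k i :
  jordan_M A k i = cayley_m (jordan_val A (i + 1) (i + 2)) k.
Proof. by rewrite jordan_M.unlock mxE. Qed.

Lemma jordan_C_hermitian A : (jordan_C A)^t* = jordan_C A.
Proof.
apply/matrixP => i j; rewrite jordan_CE !mxE jordan_CE -cayley_z_conj.
by rewrite -[in RHS](jordan_adj A) [in RHS]mxE.
Qed.

Lemma hermitian_diag X i : X^t* = X -> X i i = (complex.Re (X i i))%:C%C.
Proof.
move=> /matrixP/(_ i i); rewrite !mxE; case: (X i i) => a b; rewrite conjCE /=.
move=> [] /eqP; rewrite eq_sym -addr_eq0 -mulr2n mulrn_eq0 /= => /eqP.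
by move=> ->.
Qed.

Lemma jordan_ofC X M : X^t* = X -> jordan_C (jordan_of X M) = X.
Proof.
move=> hX; apply/matrixP => i j; rewrite jordan_CE jordan_of.unlock mxE.
have hX' k l : (X l k)^* = X k l by rewrite -[in RHS]hX !mxE.
by elim/ord3_ind: i; elim/ord3_ind: j => /=;
  rewrite ?cayley_z_conj ?cayley_z_of // ?hX' // cayley_z_real -hermitian_diag.
Qed.

Lemma jordan_ofM X M : jordan_M (jordan_of X M) = M.
Proof.
apply/matrixP => k i; rewrite jordan_ME jordan_of.unlock mxE.
by elim/ord3_ind: i => /=; rewrite cayley_m_of.
Qed.

Lemma jordan_coordP A B :
  jordan_C A = jordan_C B -> jordan_M A = jordan_M B -> A = B.
Proof.
move=> hC hM; rewrite (jordan_eltE A) (jordan_eltE B).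
have hx i : jordan_val A (i + 1) (i + 2) = jordan_val B (i + 1) (i + 2).
  apply: cayley_coordP => [|k].
    by have /matrixP/(_ (i + 1) (i + 2)) := hC; rewrite !jordan_CE.
  by have /matrixP/(_ k i) := hM; rewrite !jordan_ME.
have hxi i : cayley_re (jordan_val A i i) = cayley_re (jordan_val B i i).
  by have /matrixP/(_ i i) := hC; rewrite !jordan_CE => -[].
rewrite /jordan_xi1 /jordan_xi2 /jordan_xi3 /jordan_x1 /jordan_x2 /jordan_x3.
by rewrite !hxi; have := hx 0; have := hx 1; have := hx 2;
  rewrite !ord3_addE => -> -> ->.
Qed.

Lemma jordan_z_sym A i j :
  cayley_z (jordan_val A i j) = (cayley_z (jordan_val A j i))^*.
Proof. by rewrite -cayley_z_conj -[in LHS](jordan_adj A) mxE. Qed.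

Lemma jordan_m_sym A i j k :
  cayley_m (jordan_val A i j) k = - cayley_m (jordan_val A j i) k.
Proof. by rewrite -cayley_m_conj -[in LHS](jordan_adj A) mxE. Qed.

Lemma jordan_m_diag A i k : cayley_m (jordan_val A i i) k = 0.
Proof.
apply/eqP; have /eqP := jordan_m_sym A i i k.
by rewrite -addr_eq0 -mulr2n mulrn_eq0.
Qed.

Lemma cayley_z_sum n (f : 'I_n -> cayley R) :
  cayley_z (\sum_k f k) = \sum_k cayley_z (f k).
Proof. exact: (big_morph _ (@cayley_zD R) erefl). Qed.

Lemma cayley_m_sum n (f : 'I_n -> cayley R) l :
  cayley_m (\sum_k f k) l = \sum_k cayley_m (f k) l.
Proof.
have m0 : cayley_m (0 : cayley R) l = 0.
  by elim/ord3_ind: l; rewrite /cayley_m /= ?oppr0.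
by elim/big_rec2: _ => // k y z _ <-; exact: cayley_mD.
Qed.

Lemma half_complexE : (2^-1 : R)%:C%C = 2^-1 :> C.
Proof. by rewrite fmorphV rmorph_nat. Qed.

(** The C^3-part of an off-diagonal entry is, up to sign, the column of M at the third index. If i
    differs from j, only one inner index contributes; if i = j, the two other columns do, that is,
    the trace minus the i-th term. *)
Lemma jordan_C_mxmul A B i j : cayley_z (cayley_mx_mul A B i j) =
  (jordan_C A *m jordan_C B - (jordan_M B)^t* *m jordan_M A
   + (\tr ((jordan_M B)^t* *m jordan_M A))%:M) i j.
Proof.
rewrite mxE cayley_z_sum /mxtrace !mxE !sum3E !cayley_zM !mxE !sum3E !mxE.
rewrite !(jordan_CE, jordan_ME).
elim/ord3_ind: i; elim/ord3_ind: j; rewrite ?ord3_addE ?jordan_m_diag /=;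
  rewrite ?(jordan_m_sym _ 1 0) ?(jordan_m_sym _ 0 2) ?(jordan_m_sym _ 2 1);
  ring.
Qed.

Lemma jordan_C_mul A B : jordan_C (jordan_mul A B) =
  albertC (jordan_C A) (jordan_C B) (jordan_M A) (jordan_M B).
Proof.
apply/matrixP => i j; rewrite jordan_CE /= cayley_mxZE cayley_mxDE.
rewrite cayley_zZ cayley_zD half_complexE !jordan_C_mxmul [RHS]mxE.
congr (_ * _).
have mxDE (P Q : 'M[C]_3) : P i j + Q i j = (P + Q) i j by rewrite mxE.
rewrite mxDE raddfD /=; congr (fun_of_matrix _ i j).
by rewrite addrACA; congr (_ + _); rewrite addrACA addrA.
Qed.

Lemma jordan_M_mul A B : jordan_M (jordan_mul A B) =
  albertM (jordan_C A) (jordan_C B) (jordan_M A) (jordan_M B).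
Proof.
apply/matrixP => k i; rewrite jordan_ME /= cayley_mxZE cayley_mxDE.
rewrite cayley_mZ cayley_mD half_complexE [RHS]mxE; congr (_ * _).
rewrite ![cayley_mx_mul _ _ _ _]mxE !cayley_m_sum /mxtrace !mxE !sum3E.
rewrite !cayley_mM ?mxE ?sum3E ?mxE !(jordan_CE, jordan_ME).
elim/ord3_ind: i; rewrite ?ord3_addE ?jordan_m_diag /=;
  rewrite ?(jordan_m_sym _ 1 0) ?(jordan_m_sym _ 0 2) ?(jordan_m_sym _ 2 1);
  rewrite ?(jordan_z_sym _ 1 0) ?(jordan_z_sym _ 0 2) ?(jordan_z_sym _ 2 1);
  rewrite ?conjCK -?(jordan_z_sym _ 0 0) -?(jordan_z_sym _ 1 1);
  rewrite -?(jordan_z_sym _ 2 2); ring.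
Qed.

End JordanCoordinates.

(** * The action of U(1) x U(1) x SU(3) *)

Section Cofactor.
Variable K : comNzRingType.
Implicit Types (B M N : 'M[K]_3) (p : 'rV[K]_3).

(** The cofactor matrix; cyclic indices absorb the signs. *)
Definition cof_mx B : 'M[K]_3 :=
  \matrix_(k, i) (B (k + 1) (i + 1) * B (k + 2) (i + 2)
                - B (k + 1) (i + 2) * B (k + 2) (i + 1)).

(** Polarized form of the multiplicativity of cofactors (Cauchy-Binet for 2 x 2 minors). *)
Lemma cross_mx_mulr M N B :
  cross_mx (M *m B) (N *m B) = cross_mx M N *m cof_mx B.
Proof.
by apply/matrixP => k i; rewrite !mxE !sum3E !mxE ?ord3_addE; ring.
Qed.

Lemma cross_mx_mull p M N : cross_mx (diag_mx p *m M) (diag_mx p *m N) =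
  diag_mx (\row_k (p 0 (k + 1) * p 0 (k + 2))) *m cross_mx M N.
Proof.
by apply/matrixP => k i; rewrite !mul_diag_mx !mxE; ring.
Qed.

Lemma det_mx2 (B : 'M[K]_2) : \det B = B 0 0 * B 1 1 - B 0 1 * B 1 0.
Proof.
have sum2E (f : 'I_2 -> K) : \sum_k f k = f 0 + f 1.
  rewrite !big_ord_recl big_ord0 addr0.
  by congr (f _ + f _); apply: val_inj.
rewrite (expand_det_row _ 0) sum2E /cofactor !det_mx11 !mxE.
have l00 : lift 0 0 = 1 :> 'I_2 by apply: val_inj.
have l10 : lift 1 0 = 0 :> 'I_2 by apply: val_inj.
by rewrite !l00 l10 -[_ ^+ (0 + 0)]signr_odd -[_ ^+ (0 + 1)]signr_odd /=; ring.
Qed.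

Lemma mulmx_cof B : B *m (cof_mx B)^T = (\det B)%:M.
Proof.
have -> : (cof_mx B)^T = \adj B; last exact: mul_mx_adj.
apply/matrixP => i j; rewrite !mxE /cofactor det_mx2 !mxE.
have liftE : ((lift (0 : 'I_3) (0 : 'I_2) = 1)%R *
    (lift (0 : 'I_3) (1 : 'I_2) = 2)%R * (lift (1 : 'I_3) (0 : 'I_2) = 0)%R *
    (lift (1 : 'I_3) (1 : 'I_2) = 2)%R * (lift (2 : 'I_3) (0 : 'I_2) = 0)%R *
    (lift (2 : 'I_3) (1 : 'I_2) = 1)%R)%type.
  by do ?split; apply: val_inj.
by elim/ord3_ind: i; elim/ord3_ind: j;
  rewrite ?ord3_addE !liftE -signr_odd /=; ring.
Qed.

End Cofactor.

(** * Equivariance of the product under unitary matrices and phases *)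

Section UnitaryAction.
Variable K : numClosedFieldType.
Implicit Types (X Y M N A : 'M[K]_3) (p : 'rV[K]_3).

Lemma conjtrmx0 m n : (0 : 'M[K]_(m, n))^t* = 0.
Proof. by rewrite trmx0 map_mx0. Qed.

Lemma conjtrmxM m n q (M : 'M[K]_(m, n)) (N : 'M[K]_(n, q)) :
  (M *m N)^t* = N^t* *m M^t*.
Proof. by rewrite trmx_mul map_mxM. Qed.

Lemma conjtrmxZ m n (a : K) (M : 'M[K]_(m, n)) : (a *: M)^t* = a^* *: M^t*.
Proof. by rewrite linearZ map_mxZ. Qed.

(** At determinant 1 the transposed cofactor matrix is the inverse, which for unitary [A] is
    [A^t*]. *)
Lemma cof_unitary A : A \is unitarymx -> \det A = 1 ->
  cof_mx A = map_mx Num.conj A.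
Proof.
move=> uA dA; apply: trmx_inj; rewrite map_trmx.
have uAm := unitarymx_unit uA.
by apply: (can_inj (mulKmx uAm)); rewrite mulmx_cof dA (unitarymxP uA).
Qed.

Lemma hermitian_conj A X : X^t* = X -> (A *m X *m A^t*)^t* = A *m X *m A^t*.
Proof.
by move=> hX; rewrite !conjtrmxM trmxCK hX mulmxA.
Qed.

(** The diagonal torus of SU(3), standing for U(1) x U(1): two entries determine the third. *)
Definition phases p :=
  (forall k, p 0 k * (p 0 k)^* = 1) /\ p 0 0 * p 0 1 * p 0 2 = 1.

Section Equivariance.
Variables (A : 'M[K]_3) (p : 'rV[K]_3).
Hypotheses (uA : A \is unitarymx) (dA : \det A = 1) (hp : phases p).
Let actC X := A *m X *m A^t*.
Let actM M := diag_mx p *m M *m A^t*.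

Let uAV : A^t* *m A = 1%:M.
Proof. by apply: mulmx1C; exact/unitarymxP. Qed.
Let AK X : X *m A^t* *m A = X. Proof. by rewrite -mulmxA uAV mulmx1. Qed.
Let trA X : \tr (actC X) = \tr X.
Proof. by rewrite /actC -mulmxA mxtrace_mulC -mulmxA uAV mulmx1. Qed.
Let actMM M N : (actM M)^t* *m actM N = actC (M^t* *m N).
Proof.
have DD : (diag_mx p)^t* *m diag_mx p = 1%:M.
  rewrite tr_diag_mx map_diag_mx mulmx_diag; apply/matrixP => i j.
  by rewrite !mxE mulrC hp.1.
rewrite /actM !conjtrmxM trmxCK !mulmxA -(mulmxA _ _ (diag_mx p)) DD mulmx1.
by rewrite /actC !mulmxA.
Qed.

(** Conjugation by [A] respects products and traces, and since [diag_mx p] is unitary, Gram matrices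
    are conjugated by [A] as well ([actMM]). *)
Lemma albertC_act X Y M N :
  albertC (actC X) (actC Y) (actM M) (actM N) = actC (albertC X Y M N).
Proof.
rewrite /albertC !actMM !trA /actC -scalemxAr -scalemxAl; congr (_ *: _).
have sA z : A *m z%:M *m A^t* = z%:M.
  by rewrite mul_mx_scalar -scalemxAl (unitarymxP uA) scalemx1.
by rewrite !(mulmxDr, mulmxDl, mulmxN, mulNmx) sA !mulmxA !AK.
Qed.

(** The delicate term is the cross product. On the right it picks up the cofactor matrix of [A^t*],
    whose conjugate is again [A^t*]; on the left it picks up products of two phases, whose conjugate
    is the third phase because all three multiply to 1. *)
Lemma albertM_act X Y M N :
  albertM (actC X) (actC Y) (actM M) (actM N) = actM (albertM X Y M N).
Proof.
rewrite /albertM !trA /actM /actC -scalemxAr -scalemxAl; congr (_ *: _).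
have cofA : cof_mx (A^t*) = A^T.
  rewrite cof_unitary ?trmxC_unitary // ?det_map_mx ?det_tr ?dA ?rmorph1 //.
  by apply/matrixP => i j; rewrite !mxE conjCK.
have pp : map_mx Num.conj (\row_k (p 0 (k + 1) * p 0 (k + 2))) = p.
  have [pN pM] := hp.
  apply/rowP => k; rewrite !mxE rmorphM /=.
  have p0 l : p 0 l != 0.
    by apply: contra_eq_neq (pN l) => ->; rewrite mul0r eq_sym oner_eq0.
  have pc l : (p 0 l)^* = (p 0 l)^-1 by apply: (mulfI (p0 l)); rewrite pN mulfV.
  rewrite !pc -invfM; apply: mulr1_eq; rewrite -pM.
  by elim/ord3_ind: k; rewrite ?ord3_addE; ring.
rewrite cross_mx_mulr cross_mx_mull cofA !map_mxM map_diag_mx pp.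
rewrite !(mulmxDr, mulmxDl, mulmxN, mulNmx) ?mulmxA ?AK ?mul_mx_scalar.
by rewrite -?scalemxAl.
Qed.

End Equivariance.
End UnitaryAction.

(** No condition is put on [p] and [A], so linearity and the composition rule hold in general; w3
    and gamma3 are instances with [A] the unit matrix. *)
HB.lock Definition pair_act (R : realType) (p : 'rV[R[i]]_3) (A : 'M[R[i]]_3)
    (V : jordan R) : jordan R :=
  jordan_of (A *m jordan_C V *m A^t*) (diag_mx p *m jordan_M V *m A^t*).

Section Action.
Variable R : realType.
Local Notation C := R[i].
Implicit Types (X Y M N P A : 'M[C]_3) (p : 'rV[C]_3).

Lemma pair_actC p A V : jordan_C (pair_act p A V) = A *m jordan_C V *m A^t*.
Proof.
by rewrite pair_act.unlock jordan_ofC // hermitian_conj // jordan_C_hermitian.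
Qed.
Lemma pair_actM p A V :
  jordan_M (pair_act p A V) = diag_mx p *m jordan_M V *m A^t*.
Proof. by rewrite pair_act.unlock jordan_ofM. Qed.

Lemma jordan_valP (a : R) (U V : jordan R) :
  jordan_val (a *: U + V) = a *: jordan_val U + jordan_val V.
Proof. exact: (linearP (val : jordan R -> cayley_mx R)). Qed.

Lemma jordan_C_linear (a : R) U V :
  jordan_C (a *: U + V) = a%:C%C *: jordan_C U + jordan_C V.
Proof.
apply/matrixP => i j; rewrite jordan_CE jordan_valP cayley_mxDE cayley_mxZE.
by rewrite cayley_zD cayley_zZ !mxE !jordan_CE.
Qed.
Lemma jordan_M_linear (a : R) U V :
  jordan_M (a *: U + V) = a%:C%C *: jordan_M U + jordan_M V.
Proof.
apply/matrixP => i j; rewrite jordan_ME jordan_valP cayley_mxDE cayley_mxZE.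
by rewrite cayley_mD cayley_mZ !mxE !jordan_ME.
Qed.

Lemma pair_act_linear p A : linear (pair_act p A).
Proof.
move=> a U V; apply: jordan_coordP.
  rewrite pair_actC !jordan_C_linear !pair_actC mulmxDr mulmxDl.
  by rewrite -scalemxAr -scalemxAl.
rewrite pair_actM !jordan_M_linear !pair_actM mulmxDr mulmxDl.
by rewrite -scalemxAr -scalemxAl.
Qed.

Lemma pair_act1 (V : jordan R) : pair_act (const_mx 1) 1%:M V = V.
Proof.
by apply: jordan_coordP; rewrite ?pair_actC ?pair_actM ?diag_const_mx trmx1;
  rewrite map_mx1 !mul1mx mulmx1.
Qed.

Lemma pair_act_comp p q A B (V : jordan R) : pair_act p A (pair_act q B V) =
  pair_act (\row_k (p 0 k * q 0 k)) (A *m B) V.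
Proof.
apply: jordan_coordP.
  by rewrite !pair_actC conjtrmxM !mulmxA.
rewrite !pair_actM conjtrmxM -mulmx_diag.
move: (diag_mx p) (diag_mx q) (A^t*) (B^t*) (jordan_M V).
by move=> P Q A' B' M; rewrite !mulmxA.
Qed.

Lemma pair_act_mul p A (U V : jordan R) :
  A \is unitarymx -> \det A = 1 -> phases p ->
  pair_act p A (jordan_mul U V) = jordan_mul (pair_act p A U) (pair_act p A V).
Proof.
move=> uA dA hp; apply: jordan_coordP.
  by rewrite pair_actC !jordan_C_mul !pair_actC !pair_actM albertC_act.
by rewrite pair_actM !jordan_M_mul !pair_actC !pair_actM albertM_act.
Qed.

End Action.

(** * The homomorphism into the common centralizer of gamma3 and w3 *)

Section Hom.
Variable R : realType.
Local Notation C := R[i].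
Local Notation G := (U1_U1_SU3 R).
Implicit Types (g h : G) (V : jordan R).

Lemma F4_w3E V : F4_w3 R V = pair_act (const_mx (omega R)) 1%:M V.
Proof.
apply: jordan_coordP.
  rewrite pair_actC trmx1 map_mx1 mul1mx mulmx1.
  apply/matrixP => i j; rewrite !jordan_CE.
  by rewrite (jordan_extendE (w3_automorphism R)) cayley_z_w3.
rewrite pair_actM trmx1 map_mx1 mulmx1 mul_diag_mx.
apply/matrixP => i j; rewrite [in RHS]mxE jordan_ME.
by rewrite (jordan_extendE (w3_automorphism R)) cayley_m_w3 mxE jordan_ME.
Qed.

Lemma F4_gamma3E V : F4_gamma3 R V = pair_act (\row_k omega R ^+ k) 1%:M V.
Proof.
apply: jordan_coordP.
  rewrite pair_actC trmx1 map_mx1 mul1mx mulmx1.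
  apply/matrixP => i j; rewrite !jordan_CE.
  by rewrite (jordan_extendE (gamma3_automorphism R)) cayley_z_gamma3.
rewrite pair_actM trmx1 map_mx1 mulmx1 mul_diag_mx.
apply/matrixP => i j; rewrite [in RHS]mxE jordan_ME.
rewrite (jordan_extendE (gamma3_automorphism R)) cayley_m_gamma3.
by rewrite mxE jordan_ME.
Qed.

Definition phase_row g : 'rV[C]_3 :=
  \row_k nth 0 [:: val g.1.1; val g.1.2; (val g.1.1 * val g.1.2)^-1] k.

Lemma U1_conj (u : U1 R) : val u * (val u)^* = 1.
Proof. by rewrite -normCK U1P expr1n. Qed.

Lemma phase_rowP g : phases (phase_row g).
Proof.
split; last by rewrite !mxE /= mulfV // mulf_neq0 ?U1_neq0.
move=> k; rewrite !mxE; elim/ord3_ind: k => /=; rewrite ?U1_conj //.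
by rewrite fmorphV rmorphM -invfM mulrACA !U1_conj mulr1 invr1.
Qed.

Lemma phase_row_mul g h :
  phase_row (g * h)%g = \row_k (phase_row g 0 k * phase_row h 0 k).
Proof.
apply/rowP => k; rewrite !mxE; elim/ord3_ind: k => //=.
by rewrite -invfM mulrACA.
Qed.

Lemma phase_row1 : phase_row 1%g = const_mx 1.
Proof.
apply/rowP => k; rewrite !mxE; elim/ord3_ind: k => //=.
by rewrite mulr1 invr1.
Qed.

Definition act g := pair_act (phase_row g) (SU3_val g.2).

Lemma actM g h V : act (g * h)%g V = act g (act h V).
Proof. by rewrite /act pair_act_comp phase_row_mul. Qed.

Lemma act1 V : act 1%g V = V.
Proof. by rewrite /act phase_row1 pair_act1. Qed.

Lemma act_bij g : bijective (act g).
Proof.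
by exists (act g^-1%g) => V; rewrite -actM ?mulVg ?mulgV act1.
Qed.

Definition act_iso g : linear_iso (jordan R) :=
  LinearIso (@pair_act_linear R (phase_row g) (SU3_val g.2)) (act_bij g).

Lemma act_F4 g : act_iso g \in @F4_pred R.
Proof.
apply/asboolP => U V; apply: pair_act_mul; [exact: SU3_unitary|exact: SU3_det|].
exact: phase_rowP.
Qed.

Definition act_F4_elt g : F4 R := MkF4 (act_F4 g).

Lemma act_commute g p V : pair_act p 1%:M (act g V) = act g (pair_act p 1%:M V).
Proof.
rewrite /act !pair_act_comp mulmx1 mul1mx; congr pair_act.
by apply/rowP => k; rewrite !mxE mulrC.
Qed.

Lemma act_fixed g : act_F4_elt g \in @F4_gamma3_w3_pred R.
Proof.
apply/andP; split; apply/fixed_byP/val_inj/linear_isoP => V.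
  change (act g (F4_gamma3 R V) = F4_gamma3 R (act g V)).
  by rewrite !F4_gamma3E act_commute.
change (act g (F4_w3 R V) = F4_w3 R (act g V)).
by rewrite !F4_w3E act_commute.
Qed.

Definition act_hom g : F4_gamma3_w3 R := MkF4gw (act_fixed g).

Lemma act_homM : {morph act_hom : g h / (g * h)%g}.
Proof.
by move=> g h; apply/val_inj/val_inj/linear_isoP => V /=; exact: actM.
Qed.

Lemma act_homP g (al : F4_gamma3_w3 R) :
  (forall V, act g V = F4gw_val al V) -> act_hom g = al.
Proof. by move=> h; apply/val_inj/val_inj/linear_isoP. Qed.

End Hom.

(** * Automorphisms commuting with w3 and gamma3 *)

Section Classification.
Variable K : numClosedFieldType.
Implicit Types (X Y M N G : 'M[K]_3).

(** Commuting with the diagonal projections makes [G] diagonal; commuting with the all-ones matrix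
    makes its diagonal constant. *)
Lemma centralizer_hermitian G :
  (forall X, X^t* = X -> G *m X = X *m G) -> G = (G 0 0)%:M.
Proof.
move=> hG.
have G_diag i j : i != j -> G i j = 0.
  move=> ij; pose d : 'rV[K]_3 := delta_mx 0 i.
  have hd : (diag_mx d)^t* = diag_mx d.
    rewrite tr_diag_mx map_diag_mx; congr diag_mx.
    by apply/rowP => k; rewrite !mxE rmorph_nat.
  have /matrixP/(_ i j) := hG _ hd.
  rewrite mul_diag_mx mul_mx_diag !mxE !eqxx /=.
  by rewrite eq_sym (negPf ij) mulr0 mul1r.
have h1 : (const_mx 1 : 'M[K]_3)^t* = const_mx 1.
  by rewrite trmx_const map_const_mx conjC1.
apply/matrixP => i j; rewrite !mxE; have [<-|/G_diag//] := eqVneq i j.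
have /matrixP/(_ i 0) := hG _ h1; rewrite !mxE.
under eq_bigr do rewrite mxE mulr1; under [in RHS]eq_bigr do rewrite mxE mul1r.
rewrite (bigD1 i) //= [in RHS](bigD1 0) //= !big1 ?addr0 // => k ki.
  by rewrite G_diag.
by rewrite G_diag // eq_sym.
Qed.

(** [beta] and [L] abstract the two components of an automorphism: w3 is what keeps the summands
    apart and makes [L] complex linear, gamma3 is what gives [L_D]. *)
Variables (w : K) (beta L : 'M[K]_3 -> 'M[K]_3).
Hypotheses (w1 : w != 1) (w3 : w ^+ 3 = 1).
Let D := diag_mx (\row_k w ^+ k) : 'M[K]_3.
Hypotheses (L_lin : linear L) (L_inj : forall M, L M = 0 -> M = 0)
  (L_D : forall M, L (D *m M) = D *m L M)
  (beta0 : beta 0 = 0) (beta_herm : forall X, X^t* = X -> (beta X)^t* = beta X).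
Hypothesis beta_mul : forall X Y M N, X^t* = X -> Y^t* = Y ->
  beta (albertC X Y M N) = albertC (beta X) (beta Y) (L M) (L N).
Hypothesis L_mul : forall X Y M N, X^t* = X -> Y^t* = Y ->
  L (albertM X Y M N) = albertM (beta X) (beta Y) (L M) (L N).

HB.instance Definition _ := GRing.isLinear.Build K 'M[K]_3 'M[K]_3 _ L L_lin.

Let w_inj (i k : 'I_3) : i != k -> w ^+ i != w ^+ k.
Proof.
have w0 : w != 0.
  by apply: contra_eq_neq w3 => ->; rewrite expr0n eq_sym oner_eq0.
have w2 : w ^+ 2 != 1.
  by apply: contra_neq w1 => w2; rewrite -w3 exprS w2 mulr1.
have w21 : w ^+ 2 != w.
  by apply: contra_neq w1 => w2'; apply: (mulfI w0); rewrite mulr1 -expr2.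
by elim/ord3_ind: i; elim/ord3_ind: k; rewrite ?expr0 ?expr1 ?eqxx //= => _;
  rewrite 1?eq_sym.
Qed.

Let Q k : 'M[K]_3 := \matrix_(i, j) L (delta_mx k i) k j.

(** Matrices supported on row [k] form the eigenspace of [D] for [w ^+ k]; the eigenvalues are
    distinct and [L] commutes with [D]. *)
Let L_delta k i l : l != k -> row l (L (delta_mx k i)) = 0.
Proof.
move=> lk; apply/rowP => j; rewrite !mxE.
have /(congr1 (fun M : 'M_3 => M l j)) :
    D *m L (delta_mx k i) = w ^+ k *: L (delta_mx k i).
  rewrite -L_D -linearZ; congr L; apply/matrixP => a b.
  by rewrite mul_diag_mx !mxE; case: eqP => [->|]; rewrite //= !mulr0.
rewrite mul_diag_mx !mxE => /eqP; rewrite -subr_eq0 -mulrBl mulf_eq0 subr_eq0.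
by rewrite (negPf (w_inj lk)) => /eqP.
Qed.

Let L_row M k : row k (L M) = row k M *m Q k.
Proof.
rewrite [in LHS](matrix_sum_delta M) linear_sum; apply/rowP => j.
rewrite !mxE summxE (bigD1 k) //= [X in _ + X]big1 ?addr0 => [|l lk].
  rewrite linear_sum summxE; apply: eq_bigr => i _.
  by rewrite linearZ !mxE.
rewrite linear_sum summxE big1 // => i _; rewrite linearZ mxE.
have /rowP/(_ j) : row k (L (delta_mx l i)) = 0.
  by apply: L_delta; rewrite eq_sym.
by rewrite !mxE => ->; rewrite mulr0.
Qed.

Let Q_unit k : Q k \in unitmx.
Proof.
rewrite -row_free_unit; apply: inj_row_free => v vQ.
have : L (\matrix_i (if i == k then v else 0)) = 0.
  apply/row_matrixP => i; rewrite L_row row0 rowK.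
  by case: eqP => [->|_]; rewrite ?vQ ?mul0mx.
by move=> /L_inj/(congr1 (row k)); rewrite rowK eqxx row0.
Qed.

Let T X : 'M[K]_3 := (\tr X)%:M - X.

(** The product of (X, 0) and (0, N) has M-component N (T X) / 2, so [L] intertwines right
    multiplication by [T X] and by [T (beta X)]; this is then read on row [k]. *)
Let QT k X : X^t* = X -> T X *m Q k = Q k *m T (beta X).
Proof.
move=> hX.
have albertM_X0N Y N : albertM Y 0 0 N = 2^-1 *: (N *m T Y).
  rewrite /albertM mul0mx add0r; congr (_ *: _).
  have -> : cross_mx 0 N = 0 by apply/matrixP => a b; rewrite !mxE; ring.
  by rewrite map_mx0 subr0.
have LT N : L (N *m T X) = L N *m T (beta X).
  have := L_mul 0 N hX (conjtrmx0 _ _ _).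
  rewrite beta0 linear0 !albertM_X0N linearZ.
  by apply: scalerI; rewrite invr_eq0 pnatr_eq0.
apply/row_matrixP => i; rewrite !rowE !mulmxA.
pose N : 'M[K]_3 := \matrix_l delta_mx 0 i.
have /(congr1 (row k)) := LT N.
by rewrite L_row !row_mul L_row rowK.
Qed.

Let trT X : \tr (T X) = 2 * \tr X.
Proof. by rewrite linearB /= mxtrace_scalar; ring. Qed.

(** By [QT], [T X] and [T (beta X)] are similar. *)
Let tr_beta X : X^t* = X -> \tr (beta X) = \tr X.
Proof.
move=> hX; have /(congr1 (fun M => \tr (M *m invmx (Q 0)))) := QT 0 hX.
rewrite mulmxK // mxtrace_mulC mulKmx // !trT => /esym.
by apply: mulfI; rewrite pnatr_eq0.
Qed.

Let Q_beta k X : X^t* = X -> X *m Q k = Q k *m beta X.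
Proof.
move=> hX; have := QT k hX.
rewrite /T tr_beta // mulmxBl mulmxBr mul_scalar_mx mul_mx_scalar.
by move=> /(congr1 (fun M => \tr X *: Q k - M)); rewrite !subKr.
Qed.

Let c k := (Q k *m invmx (Q 0)) 0 0.

(** Every [Q k] conjugates [X] to the same [beta X], so the quotient of two of them centralizes the
    Hermitian matrices. *)
Let Q_scale k : Q k = c k *: Q 0.
Proof.
rewrite -mul_scalar_mx -centralizer_hermitian ?mulmxKV // => X hX.
rewrite mulmxA Q_beta // -!mulmxA; congr (_ *m _).
apply: (can_inj (mulKmx (Q_unit 0))).
by rewrite mulKVmx // mulmxA -Q_beta // mulmxK.
Qed.

Let c0 : c 0 = 1. Proof. by rewrite /c mulmxV // mxE. Qed.

Let L_form M : L M = diag_mx (\row_k c k) *m M *m Q 0.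
Proof.
apply/row_matrixP => k; rewrite L_row Q_scale -scalemxAr row_mul scalemxAl.
congr (_ *m _); apply/rowP => j.
by rewrite mul_diag_mx !mxE.
Qed.

Let s := (Q 0 *m (Q 0)^t*) 0 0.

(** As [beta X] is Hermitian, taking adjoints in [Q_beta] shows that this product commutes with
    every Hermitian [X]. *)
Let QQs : Q 0 *m (Q 0)^t* = s%:M.
Proof.
apply: centralizer_hermitian => X hX.
have hQ : (Q 0)^t* *m X = beta X *m (Q 0)^t*.
  by rewrite -[in LHS]hX -conjtrmxM Q_beta // conjtrmxM beta_herm.
by rewrite -mulmxA hQ mulmxA -Q_beta // mulmxA.
Qed.

(** The square of (0, M) has Hermitian component [T (M^t* *m M)], and [beta] preserves traces. *)
Let tr_gram M : \tr ((L M)^t* *m L M) = \tr (M^t* *m M).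
Proof.
have albertC00 N : albertC 0 0 N N = T (N^t* *m N).
  rewrite /albertC /T !mul0mx; move: (N^t* *m N) => Y.
  by apply/matrixP => i j; rewrite !mxE; case: (i == j) => /=; field.
have hG : (M^t* *m M)^t* = M^t* *m M by rewrite conjtrmxM trmxCK.
have hT Y : Y^t* = Y -> (T Y)^t* = T Y.
  move=> hY; have hYE i j : (Y j i)^* = Y i j by rewrite -[in RHS]hY !mxE.
  apply/matrixP => i j; rewrite !mxE rmorphB /= rmorphMn /= hYE eq_sym.
  congr (_ *+ _ - _); rewrite /mxtrace rmorph_sum /=.
  by apply: eq_bigr => l _; rewrite hYE.
have /(congr1 mxtrace) := beta_mul M M (conjtrmx0 _ _ _) (conjtrmx0 _ _ _).
rewrite beta0 !albertC00 tr_beta ?hT // !trT => /esym.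
by apply: mulfI; rewrite pnatr_eq0.
Qed.

Let cs k : c k * (c k)^* * s = 1.
Proof.
have trD : \tr ((delta_mx k 0 : 'M[K]_3)^t* *m delta_mx k 0) = 1.
  have -> : (delta_mx k 0 : 'M[K]_3)^t* = delta_mx 0 k.
    by apply/matrixP => i j; rewrite !mxE rmorph_nat andbC.
  by rewrite mul_delta_mx /mxtrace sum3E !mxE /= !addr0.
have := tr_gram (delta_mx k 0); rewrite trD => <-; rewrite L_form.
have -> : diag_mx (\row_k c k) *m delta_mx k 0 = c k *: delta_mx k 0 :> 'M_3.
  apply/matrixP => i j; rewrite mul_diag_mx !mxE.
  by case: eqP => [->|]; rewrite //= !mulr0.
rewrite !conjtrmxM mulmxA mxtrace_mulC -!mulmxA [Q 0 *m (_ *m _)]mulmxA QQs.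
rewrite conjtrmxZ mul_scalar_mx -scalemxAl -scalemxAr.
by rewrite !mxtraceZ trD /=; ring.
Qed.

Let s1 : s = 1. Proof. by have := cs 0; rewrite c0 conjC1 !mul1r. Qed.

Let c_unit k : c k * (c k)^* = 1. Proof. by have := cs k; rewrite s1 mulr1. Qed.

Let Q_adj : invmx (Q 0) = (Q 0)^t*.
Proof.
by apply: (can_inj (mulKmx (Q_unit 0))); rewrite mulmxV // QQs s1.
Qed.

Let d := \det (Q 0).

Let d_unit : d * d^* = 1.
Proof.
have /(congr1 determinant) := QQs.
by rewrite s1 det_mulmx det_map_mx det_tr det1.
Qed.

Let cof_Q : cof_mx (Q 0) = d *: map_mx Num.conj (Q 0).
Proof.
apply: trmx_inj; apply: (can_inj (mulKmx (Q_unit 0))).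
rewrite mulmx_cof linearZ /= -scalemxAr -/d.
by rewrite map_trmx QQs s1 scalemx1.
Qed.

(** Squaring (0, 1) and applying [L] shows that [c k] is the conjugate of
    [c (k + 1) * c (k + 2) * d]; the case k = 0 is read off, where [c 0 = 1]. *)
Let c_det : c 1 * c 2 * d = 1.
Proof.
have cross11 : cross_mx 1%:M 1%:M = 2%:M :> 'M[K]_3.
  apply/matrixP => k i; rewrite !mxE.
  by elim/ord3_ind: k; elim/ord3_ind: i; rewrite ?ord3_addE /=; ring.
have a00 M N : albertM 0 0 M N = - 2^-1 *: map_mx Num.conj (cross_mx M N).
  rewrite /albertM linear0 raddf0 subrr !mulmx0 addr0 sub0r scalerN.
  by rewrite scaleNr.
have := L_mul 1%:M 1%:M (conjtrmx0 _ _ _) (conjtrmx0 _ _ _).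
rewrite beta0 !a00 cross11 linearZ => /(scalerI _).
have h2 : - 2^-1 != 0 :> K by rewrite oppr_eq0 invr_eq0 pnatr_eq0.
move=> /(_ h2); rewrite !L_form mulmx1 cross_mx_mulr.
have conj2 : map_mx Num.conj 2%:M = 2%:M :> 'M[K]_3.
  by rewrite map_scalar_mx /= rmorph_nat.
rewrite -[LHS]/(L _) conj2 L_form -[diag_mx _ in RHS]mulmx1 cross_mx_mull.
rewrite cross11 cof_Q.
rewrite -scalemxAr map_mxZ !map_mxM conj2 map_diag_mx !mul_mx_scalar.
have -> : map_mx Num.conj (map_mx Num.conj (Q 0)) = Q 0.
  by apply/matrixP => i j; rewrite !mxE conjCK.
move=> /(congr1 (fun M => (M *m invmx (Q 0)) 0 0)).
rewrite -!scalemxAl !mulmxK // !mxE /= c0 !mulr1n !ord3_addE !rmorphM /= mulrCA.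
have two0 : 2 != 0 :> K by rewrite pnatr_eq0.
move=> /(mulfI two0)/(congr1 Num.conj).
by rewrite rmorph1 !rmorphM /= !conjCK => ->; rewrite mulrC.
Qed.

Theorem albert_pair_form : exists p A,
  [/\ A \is unitarymx, \det A = 1, phases p,
      forall X, X^t* = X -> beta X = A *m X *m A^t* &
      forall M, L M = diag_mx p *m M *m A^t*].
Proof.
(* [d^*] is the inverse of [d], so [e *: Q 0] has determinant 1, and the phases absorb the factor
   [e^-1]. The choice of cube root is exactly the Z_3 ambiguity. *)
pose e := 3.-root d^*.
have e3 : e ^+ 3 = d^* by rewrite rootCK.
have e1 : e * e^* = 1.
  rewrite -normCK; have /eqP : `|e| ^+ 3 = 1.
    apply/eqP; rewrite -normrX e3 norm_conjC -(@eqrXn2 _ 2) ?ler01 //.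
    by rewrite normCK d_unit expr1n.
  by rewrite pexpr_eq1 // => /eqP ->; rewrite expr1n.
have eV : (e^-1)^* = e.
  by rewrite fmorphV; apply: mulr1_eq; rewrite mulrC.
pose A := e^-1 *: (Q 0)^t*.
have AE : A^t* = e *: Q 0 by rewrite /A conjtrmxZ trmxCK eV.
have e0 : e != 0.
  by apply: contra_eq_neq e1 => ->; rewrite mul0r eq_sym oner_eq0.
exists (\row_k (c k * e^-1)), A; split.
- apply/unitarymxP; rewrite AE -scalemxAr -scalemxAl scalerA mulfV // scale1r.
  by rewrite -Q_adj mulVmx.
- rewrite detZ det_map_mx det_tr -/d exprVn e3 mulVf //.
  by apply: contra_eq_neq d_unit => ->; rewrite mulr0 eq_sym oner_eq0.
- split=> [k|]; rewrite !mxE.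
    rewrite rmorphM /= eV mulrACA c_unit mulVf ?mulr1 //.
  rewrite c0 mul1r -[RHS]c_det -(_ : (e ^+ 3)^-1 = d).
    by rewrite !exprS expr0 mulr1 !invfM; ring.
  by rewrite e3; apply: mulr1_eq; rewrite mulrC.
- move=> X hX; rewrite AE -scalemxAr -!scalemxAl scalerA mulfV // scale1r.
  by rewrite -Q_adj -mulmxA Q_beta // mulKmx.
move=> M; rewrite L_form AE -scalemxAr scalemxAl; congr (_ *m _).
apply/matrixP => i j; rewrite !mul_diag_mx !mxE mulrA; congr (_ * _).
by rewrite mulrCA mulfV ?mulr1.
Qed.

End Classification.

(** * The kernel *)

Section Kernel.
Variable R : realType.
Local Notation C := R[i].
Local Notation G := (U1_U1_SU3 R).
Local Notation w := (omega R).
Implicit Types (g : G) (V : jordan R) (X Y M N : 'M[C]_3).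

Lemma omega_sum : 1 + w + w ^+ 2 = 0.
Proof.
apply/eqP; rewrite exprS expr1 eq_complex /=.
by apply/andP; split; apply/eqP; field: (sqrt3K R).
Qed.

Lemma omega_neq1 : w != 1.
Proof.
apply/eqP => w1; have /eqP := omega_sum; rewrite w1 expr1n -mulr2n -mulrSr.
by rewrite pnatr_eq0.
Qed.

Lemma omegaV : w^-1 = w ^+ 2.
Proof. by apply: mulr1_eq; rewrite -exprS omega3. Qed.

Lemma cube_root_unity (c : C) : c ^+ 3 = 1 -> [\/ c = 1, c = w | c = w^-1].
Proof.
move=> c3; have /eqP : (c - 1) * ((c - w) * (c - w ^+ 2)) = 0.
  have -> : (c - 1) * ((c - w) * (c - w ^+ 2)) =
      c ^+ 3 - 1 - (1 + w + w ^+ 2) * (c ^+ 2 - w * c) + (1 - w ^+ 3).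
    ring.
  by rewrite c3 omega3 omega_sum; ring.
rewrite !mulf_eq0 !subr_eq0 omegaV => /or3P[] /eqP ->;
  [exact: Or31|exact: Or32|exact: Or33].
Qed.

Lemma Z3P g :
  reflect (exists c : C,
      [/\ c ^+ 3 = 1, val g.1.1 = c, val g.1.2 = c & val g.2 = c%:M])
    (g \in @Z3_pred R).
Proof.
have wV3 : w^-1 ^+ 3 = 1 by rewrite exprVn omega3 invr1.
rewrite !inE !xpair_eqE /= -!andbA.
apply: (iffP or3P) => [[] /and3P[/eqP ha /eqP hb /eqP hA]|].
- by exists 1; rewrite expr1n.
- by exists w; rewrite omega3.
- by exists w^-1.
move=> [c [/cube_root_unity c3 ha hb hA]]; rewrite ha hb hA.
case: c3 => ->; rewrite !eqxx;
  [exact: Or31|exact: Or32|exact: Or33].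
Qed.

Lemma Z3_act g V : g \in @Z3_pred R -> act g V = V.
Proof.
move=> /Z3P[c [c3 ha hb hA]].
have cc : c * c^* = 1 by rewrite -ha U1_conj.
have AE : (SU3_val g.2)^t* = (c^*)%:M by rewrite hA tr_scalar_mx map_scalar_mx.
apply: jordan_coordP; rewrite /act ?pair_actC ?pair_actM AE mul_mx_scalar.
  by rewrite [SU3_val _]hA mul_scalar_mx scalerA mulrC cc scale1r.
(* The third phase is the inverse of [c * c], that is, [c] again. *)
have -> : phase_row g = const_mx c.
  apply/rowP => k; rewrite !mxE ha hb; elim/ord3_ind: k => //=.
  by apply: mulr1_eq; rewrite -c3 !exprS expr0 mulr1 mulrA.
by rewrite diag_const_mx mul_scalar_mx scalerA mulrC cc scale1r.
Qed.

(** Evaluating at M = 1 gives [diag_mx p = A]; evaluating at the all-ones matrix makes the phases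
    equal, and their product 1 makes the common value a cube root of unity. *)
Lemma act_Z3 g : (forall V, act g V = V) -> g \in @Z3_pred R.
Proof.
move=> hg; set p := phase_row g; set A := SU3_val g.2.
have hM M : diag_mx p *m M *m A^t* = M.
  have /(congr1 (@jordan_M R)) := hg (jordan_of 0 M).
  by rewrite /act pair_actM jordan_ofM.
have uAV : A^t* *m A = 1%:M.
  by apply: mulmx1C; exact/unitarymxP/SU3_unitary.
have hA : diag_mx p = A.
  have := hM 1%:M; rewrite mulmx1 => /(congr1 (mulmx^~ A)).
  by rewrite mul1mx -mulmxA uAV mulmx1.
have [pN pM] : phases p := phase_rowP g.
have pE i j : p 0 i = p 0 j.
  have h : p 0 i * (p 0 j)^* = 1.
    have /matrixP/(_ i j) := hM (const_mx 1).
    by rewrite -hA tr_diag_mx map_diag_mx mul_diag_mx mul_mx_diag !mxE mulr1.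
  by rewrite -[LHS]mulr1 -(pN j) mulrCA h mulr1.
apply/Z3P; exists (p 0 0); split.
- by rewrite -pM (pE 1 0) (pE 2 0) !exprS expr0 mulr1 mulrA.
- by rewrite mxE.
- by rewrite (pE 0 1) mxE.
rewrite -[LHS]/A -hA -diag_const_mx; congr diag_mx.
by apply/rowP => j; rewrite [RHS]mxE (pE j 0).
Qed.

End Kernel.

(** * Surjectivity *)

Section Surjectivity.
Variable R : realType.
Local Notation C := R[i].
Local Notation w := (omega R).
Implicit Types (V : jordan R) (X Y M N : 'M[C]_3).

Lemma jordan_C_add U V : jordan_C (U + V) = jordan_C U + jordan_C V.
Proof. by have := @jordan_C_linear R 1 U V; rewrite !scale1r. Qed.
Lemma jordan_M_add U V : jordan_M (U + V) = jordan_M U + jordan_M V.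
Proof. by have := @jordan_M_linear R 1 U V; rewrite !scale1r. Qed.

Lemma jordan_of0_linear (a : R) M N :
  jordan_of 0 (a%:C%C *: M + N) = a *: jordan_of 0 M + jordan_of 0 N.
Proof.
apply: jordan_coordP.
  by rewrite jordan_C_linear !jordan_ofC ?conjtrmx0 // scaler0 addr0.
by rewrite jordan_M_linear !jordan_ofM.
Qed.

Lemma jordan_of00 : jordan_of 0 0 = 0 :> jordan R.
Proof.
have := jordan_of0_linear 1 0 0; rewrite scale1r addr0 scale1r.
by move=> /(congr1 (fun V => V - jordan_of 0 0)); rewrite subrr addrK.
Qed.

Lemma jordan_of_split V :
  V = jordan_of (jordan_C V) 0 + jordan_of 0 (jordan_M V).
Proof.
apply: jordan_coordP.
  by rewrite jordan_C_add !jordan_ofC ?conjtrmx0 ?jordan_C_hermitian // addr0.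
by rewrite jordan_M_add !jordan_ofM add0r.
Qed.

Lemma pair_act_jordan_of0 p M :
  pair_act p 1%:M (jordan_of 0 M) = jordan_of 0 (diag_mx p *m M) :> jordan R.
Proof.
apply: jordan_coordP.
  by rewrite pair_actC !jordan_ofC ?conjtrmx0 // mulmx0 mul0mx.
by rewrite pair_actM !jordan_ofM trmx1 map_mx1 mulmx1.
Qed.

Variable al : F4_gamma3_w3 R.
Let f : linear_iso (jordan R) := F4_val (F4gw_val al).

Let f_mul U V : f (jordan_mul U V) = jordan_mul (f U) (f V).
Proof. by rewrite /f; case: (F4gw_val al) => g /= /asboolP. Qed.

Let f_gamma3 V :
  f (pair_act (\row_k w ^+ k) 1%:M V) = pair_act (\row_k w ^+ k) 1%:M (f V).
Proof.
rewrite -!F4_gamma3E /f; case: al => g /= /andP[/fixed_byP hg _].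
by have /(congr1 (fun h : F4 R => F4_val h V)) := hg.
Qed.

Let f_w3 V :
  f (pair_act (const_mx w) 1%:M V) = pair_act (const_mx w) 1%:M (f V).
Proof.
rewrite -!F4_w3E /f; case: al => g /= /andP[_ /fixed_byP hg].
by have /(congr1 (fun h : F4 R => F4_val h V)) := hg.
Qed.

Let beta X : 'M[C]_3 := jordan_C (f (jordan_of X 0)).
Let L M : 'M[C]_3 := jordan_M (f (jordan_of 0 M)).

(** w3 fixes (X, 0), hence its image, whose M-component is thus equal to omega times itself. *)
Let f_jordan_ofC X : X^t* = X -> jordan_M (f (jordan_of X 0)) = 0.
Proof.
move=> hX; have := f_w3 (jordan_of X 0).
have -> : pair_act (const_mx w) 1%:M (jordan_of X 0) = jordan_of X 0.
  apply: jordan_coordP; rewrite ?pair_actC ?pair_actM;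
    rewrite !(jordan_ofM, jordan_ofC) // ?mulmx0 ?mul0mx //.
  by rewrite trmx1 map_mx1 mul1mx mulmx1.
move=> /(congr1 (@jordan_M R)).
rewrite pair_actM trmx1 map_mx1 mulmx1 diag_const_mx mul_scalar_mx => /eqP.
rewrite -subr_eq0 -{1}[jordan_M _]scale1r -scalerBl scaler_eq0 subr_eq0.
by rewrite eq_sym (negPf (omega_neq1 R)) => /eqP.
Qed.

Let f_jordan_of0_linear (a : R) M N :
  f (jordan_of 0 (a%:C%C *: M + N)) =
  a *: f (jordan_of 0 M) + f (jordan_of 0 N).
Proof. by rewrite jordan_of0_linear linearP. Qed.

(** The Hermitian component of the image is unchanged when M is multiplied by omega, so summing over
    1, omega, omega^2, whose sum is 0, gives three times it. *)
Let f_jordan_ofM M : jordan_C (f (jordan_of 0 M)) = 0.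
Proof.
have inv N : jordan_C (f (jordan_of 0 (w *: N))) = jordan_C (f (jordan_of 0 N)).
  have := f_w3 (jordan_of 0 N).
  rewrite pair_act_jordan_of0 diag_const_mx mul_scalar_mx => ->.
  by rewrite pair_actC trmx1 map_mx1 mul1mx mulmx1.
have addf N N' : jordan_C (f (jordan_of 0 (N + N'))) =
    jordan_C (f (jordan_of 0 N)) + jordan_C (f (jordan_of 0 N')).
  have := f_jordan_of0_linear 1 N N'; rewrite !scale1r => ->.
  by rewrite jordan_C_add.
have : jordan_C (f (jordan_of 0 (M + w *: M + w *: (w *: M)))) = 0.
  have -> : M + w *: M + w *: (w *: M) = 0.
    rewrite scalerA -expr2 -{1}[M]scale1r -!scalerDl omega_sum.
    by rewrite scale0r.
  by rewrite jordan_of00 linear0 -jordan_of00 jordan_ofC ?conjtrmx0.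
rewrite !addf !inv -mulr2n -mulrSr => /eqP.
by rewrite -scaler_nat scaler_eq0 pnatr_eq0 => /eqP.
Qed.

Let jordan_C_f V : jordan_C (f V) = beta (jordan_C V).
Proof.
rewrite {1}(jordan_of_split V) linearD /= jordan_C_add.
by rewrite f_jordan_ofM addr0.
Qed.

Let jordan_M_f V : jordan_M (f V) = L (jordan_M V).
Proof.
rewrite {1}(jordan_of_split V) linearD /= jordan_M_add.
by rewrite f_jordan_ofC ?jordan_C_hermitian // add0r.
Qed.

Let L_linear : linear L.
Proof.
have L_real (a : R) M N : L (a%:C%C *: M + N) = a%:C%C *: L M + L N.
  by rewrite /L f_jordan_of0_linear jordan_M_linear.
have L_w M : L (w *: M) = w *: L M.
  have := f_w3 (jordan_of 0 M).
  rewrite pair_act_jordan_of0 diag_const_mx mul_scalar_mx /L => ->.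
  by rewrite pair_actM trmx1 map_mx1 mulmx1 diag_const_mx mul_scalar_mx.
move=> c M N.
(* [b] is the omega-coordinate of [c] in the real basis 1, omega of the complex numbers; real
   linearity and commutation with omega therefore suffice. *)
pose b : R := 2 * complex.Im c / Num.sqrt 3.
have s3 : Num.sqrt 3 != 0 :> R by rewrite gt_eqF // sqrtr_gt0 ltr0n.
have cE : c = (complex.Re c + b / 2)%:C%C + b%:C%C * w.
  by apply/eqP; rewrite eq_complex /=; apply/andP; split; apply/eqP;
    rewrite /b; field.
by rewrite cE !scalerDl -!scalerA -!addrA !L_real L_w.
Qed.

Let L_inj M : L M = 0 -> M = 0.
Proof.
move=> LM; have /(bij_inj (linear_iso_bij f)) : f (jordan_of 0 M) = f 0.
  rewrite linear0 -jordan_of00; apply: jordan_coordP.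
    by rewrite f_jordan_ofM jordan_ofC // conjtrmx0.
  by rewrite jordan_ofM.
by move=> /(congr1 (@jordan_M R)); rewrite jordan_ofM -jordan_of00 jordan_ofM.
Qed.

Let L_D M : L (diag_mx (\row_k w ^+ k) *m M) = diag_mx (\row_k w ^+ k) *m L M.
Proof.
by rewrite /L -pair_act_jordan_of0 f_gamma3 pair_actM trmx1 map_mx1 mulmx1.
Qed.

Let beta0 : beta 0 = 0. Proof. exact: f_jordan_ofM. Qed.

Let beta_herm X : X^t* = X -> (beta X)^t* = beta X.
Proof. by rewrite jordan_C_hermitian. Qed.

Let beta_mul X Y M N : X^t* = X -> Y^t* = Y ->
  beta (albertC X Y M N) = albertC (beta X) (beta Y) (L M) (L N).
Proof.
move=> hX hY; pose U := jordan_of X M; pose V := jordan_of Y N.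
have [UX UM] : jordan_C U = X /\ jordan_M U = M.
  by rewrite jordan_ofC // jordan_ofM.
have [VX VM] : jordan_C V = Y /\ jordan_M V = N.
  by rewrite jordan_ofC // jordan_ofM.
rewrite -UX -VX -UM -VM -jordan_C_mul -jordan_C_f f_mul jordan_C_mul.
by rewrite !jordan_C_f !jordan_M_f.
Qed.

Let L_mul X Y M N : X^t* = X -> Y^t* = Y ->
  L (albertM X Y M N) = albertM (beta X) (beta Y) (L M) (L N).
Proof.
move=> hX hY; pose U := jordan_of X M; pose V := jordan_of Y N.
have [UX UM] : jordan_C U = X /\ jordan_M U = M.
  by rewrite jordan_ofC // jordan_ofM.
have [VX VM] : jordan_C V = Y /\ jordan_M V = N.
  by rewrite jordan_ofC // jordan_ofM.
rewrite -UX -VX -UM -VM -jordan_M_mul -jordan_M_f f_mul jordan_M_mul.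
by rewrite !jordan_C_f !jordan_M_f.
Qed.

Lemma act_hom_surj : exists g, act_hom g = al.
Proof.
have [p [A [uA dA hp betaE LE]]] := albert_pair_form (omega_neq1 R) (omega3 R)
  L_linear L_inj L_D beta0 beta_herm beta_mul L_mul.
have [pN pM] := hp.
have pU k : `|p 0 k| == 1.
  by rewrite -(@eqrXn2 _ 2) ?ler01 // normCK pN expr1n.
have sA : (A \is unitarymx) && (\det A == 1) by rewrite uA dA eqxx.
(* Two phases suffice: the third is recovered from the product being 1. *)
exists (MkU1 (pU 0), MkU1 (pU 1), MkSU3 sA); apply: act_homP => V.
have pE : phase_row (MkU1 (pU 0), MkU1 (pU 1), MkSU3 sA) = p.
  apply/rowP => k; rewrite mxE; elim/ord3_ind: k => //=.
  exact: mulr1_eq.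
rewrite -[RHS]/(f V) /act pE; apply: jordan_coordP.
  by rewrite pair_actC jordan_C_f betaE // jordan_C_hermitian.
by rewrite pair_actM jordan_M_f LE.
Qed.

End Surjectivity.

(** * Passage to the quotient by Z_3 *)

Theorem theorem4p3p2 (R : realType) :
  isomorphic (F4_gamma3_w3 R) (quotient_group (Z3 R)).
Proof.
apply: (@surjective_hom_isomorphic _ _ (Z3 R) (@act_hom R)).
- exact: act_homM.
- exact: act_hom_surj.
- move=> g hg; apply: act_Z3 => V.
  by have /(congr1 (fun h => F4gw_val h V)) := hg.
- by move=> g hg; apply: act_homP => V; rewrite Z3_act.
Qed.
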